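(* Let $1<k\le n$, $a\in\mathbb{R}^{n+1}\setminus\{0\}$, $\tilde a=a/|a|$, and $f\in C(\mathbb{S}^n)$. Let $\zeta\equiv\zeta(\zeta_0,u)=\zeta_0+u\in\mathcal{Z}_a(n+1,k)$, where $\zeta_0$ is a $k$-dimensional linear subspace of $\mathbb{R}^{n+1}$ containing $a$, $u\in\zeta_0^\perp\cap a^\perp$ and $|u|<1$. Then $$(\Pi_af)(\zeta)=(1-|u|^2)^{1/2}\,(R\varphi)(a^\perp\cap\zeta),$$ where $\varphi$ is the function on the ball $\{y\in a^\perp:|y|<1\}$ defined by $$\varphi(y)=2(1-|y|^2)^{-1/2}f\big(y+\sqrt{1-|y|^2}\,\tilde a\big)$$ and $R$ is the Radon–John transform over $(k-1)$-planes in $a^\perp$.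
   Context: $\mathbb{S}^n$ is the unit sphere and $\mathbb{B}^{n+1}$ the open unit ball in $\mathbb{R}^{n+1}$; $a^\perp$ is the linear hyperplane orthogonal to $a$. $\mathcal{Z}_a(n+1,k)$ is the set of all $k$-dimensional affine planes in $\mathbb{R}^{n+1}$ that are parallel to the vector $a$ and meet $\mathbb{B}^{n+1}$; each such plane has the form $\zeta_0+u$ as in the claim. The parallel slice transform is $$(\Pi_af)(\zeta)=\int_{\mathbb{S}^n\cap\zeta}f(x)\,d\sigma(x),\qquad\zeta\in\mathcal{Z}_a(n+1,k),$$ with $d\sigma$ the $(k-1)$-dimensional surface area measure on the subsphere $\mathbb{S}^n\cap\zeta$. The Radon–John transform of a function $\varphi$ on $a^\perp\cong\mathbb{R}^n$ over a $(k-1)$-dimensional affine plane $\tau\subset a^\perp$ is the integral of $\varphi$ over $\tau$ with respect to $(k-1)$-dimensional Lebesgue measure; for a function given only on the open unit ball of $a^\perp$, the integral is over the part of $\tau$ in that ball.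
   Formalization: The identity fails for general f (e.g. f(x)=⟨x,ã⟩: left side 0, right side positive); proved instead for every f in C(S^n) with φ built from the even part of f under reflection in a^⊥, and verbatim when f is invariant under that reflection. *)

(* Defs.v *)
From HB Require Import structures.
From mathcomp Require Import all_boot all_order all_algebra.
From mathcomp Require Import all_classical all_reals all_analysis.
From mathcomp Require Import measurable_realfun.

Set Implicit Arguments.
Unset Strict Implicit.
Unset Printing Implicit Defensive.

Import Order.TTheory GRing.Theory Num.Theory.
Import numFieldNormedType.Exports.

Local Open Scope classical_set_scope.
Local Open Scope ring_scope.

Section euclidean.
Context {R : realType} {m : nat}.
Implicit Types (x y a : 'rV[R]_m) (W : {vspace 'rV[R]_m}).

Definition dotv x y : R := (x *m y^T) 0 0.

(* The library norm [`|x|] on matrices is the sup norm. *)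
Definition enorm x : R := Num.sqrt (dotv x x).

Definition unit_sphere : set 'rV[R]_m := [set x | enorm x = 1].
Definition unit_ball : set 'rV[R]_m := [set x | enorm x < 1].

Definition hyperplane a : set 'rV[R]_m := [set x | dotv x a = 0].

Definition orthocomplement W : set 'rV[R]_m :=
  [set x | forall w, w \in W -> dotv x w = 0].

Definition affine_plane W x : set 'rV[R]_m := [set x + w | w in [set` W]].

Definition parallel_planes (k : nat) a : set (set 'rV[R]_m) :=
  [set zeta | (exists W x, [/\ zeta = affine_plane W x, \dim W = k & a \in W])
              /\ zeta `&` unit_ball !=set0].

Definition unit_vector a : 'rV[R]_m := (enorm a)^-1 *: a.

Definition reflection a x : 'rV[R]_m :=
  x - (2 * dotv x (unit_vector a)) *: unit_vector a.

(* Slices parallel to a are invariant under [reflection a], so the slice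
   transform sees only this part of f. *)
Definition even_part a (f : 'rV[R]_m -> R) x : R :=
  (f x + f (reflection a x)) / 2.

End euclidean.

Section lebesgue_tuple.
Context (R : realType).

Definition tuple_of_pair d (p : R * d.-tuple R) : d.+1.-tuple R :=
  [the d.+1.-tuple R of p.1 :: p.2].

Lemma measurable_tuple_of_pair d : measurable_fun setT (@tuple_of_pair d).
Proof.
by apply: measurable_cons; [exact: measurable_fst|exact: measurable_snd].
Qed.

Section step.
Variables (d : nat) (mu : {sigma_finite_measure set (d.-tuple R) -> \bar R}).

Definition lebesgue_step : set (d.+1.-tuple R) -> \bar R :=
  pushforward (lebesgue_measure \x mu)%E (@tuple_of_pair d).

Let step0 : lebesgue_step set0 = 0%E.
Proof. by rewrite /lebesgue_step /pushforward preimage_set0 measure0. Qed.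

Let step_ge0 A : (0 <= lebesgue_step A)%E.
Proof. by rewrite /lebesgue_step /pushforward; exact: measure_ge0. Qed.

Let step_sigma_additive : semi_sigma_additive lebesgue_step.
Proof.
have H := @measure_semi_sigma_additive _ _ _
  (measure_function_pushforward__canonical__measure_function_Measure
    (lebesgue_measure \x mu)%E (@measurable_tuple_of_pair d)).
exact: H.
Qed.

HB.instance Definition _ := isMeasure.Build _ _ _ lebesgue_step
  step0 step_ge0 step_sigma_additive.

Let step_sigma_finite : sigma_finite setT lebesgue_step.
Proof.
have /sigma_finiteP[F [TF ndF Foo]] := sigma_finiteT (@lebesgue_measure R).
have /sigma_finiteP[G [TG ndG Goo]] := sigma_finiteT mu.
pose g (t : d.+1.-tuple R) : R * d.-tuple R := (thead t, [tuple of behead t]).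
have gK : cancel (@tuple_of_pair d) g.
  by move=> [x t]; rewrite /g /tuple_of_pair theadE; congr (_, _); exact: val_inj.
have mg : measurable_fun setT g.
  apply: measurable_fun_pair; first exact: (@measurable_tnth _ _ _ ord0).
  exact: measurable_behead.
exists (fun n => g @^-1` (F n `*` G n)) => [|n].
  apply/seteqP; split => // t _.
  have [n _ Fn] : (\bigcup_i F i) (g t).1 by rewrite -TF.
  have [p _ Gp] : (\bigcup_i G i) (g t).2 by rewrite -TG.
  exists (maxn n p) => //; split.
    by move: Fn; exact/subsetPset/ndF/leq_maxl.
  by move: Gp; exact/subsetPset/ndG/leq_maxr.
have [mF Fn] := Foo n; have [mG Gn] := Goo n; split.
  by rewrite -[X in measurable X]setTI; apply: mg => //; exact: measurableX.
rewrite /lebesgue_step /pushforward -comp_preimage.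
rewrite (_ : g \o @tuple_of_pair d = id) ?preimage_id; last first.
  by apply/funext => p; exact: gK.
by rewrite product_measure1E// lte_mul_pinfty// ge0_fin_numE.
Qed.

HB.instance Definition _ := Measure_isSigmaFinite.Build _ _ _
  lebesgue_step step_sigma_finite.

End step.

(* Lebesgue measure on R^d as the d-fold product of [lebesgue_measure]; R^d is
   [d.-tuple R] here because the library puts a sigma-algebra on tuples but not
   on row vectors. *)
Fixpoint lebesgue_tuple d : {sigma_finite_measure set (d.-tuple R) -> \bar R} :=
  if d is d'.+1 then [the sigma_finite_measure _ _ of lebesgue_step (lebesgue_tuple d')]
  else [the sigma_finite_measure _ _ of dirac [tuple]].

End lebesgue_tuple.

Section sphere_measure.
Context (R : realType) (d : nat).

Definition row_of_tuple (s : d.-tuple R) : 'rV[R]_d := \row_i tnth s i.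

Definition punctured_ball : set (d.-tuple R) :=
  [set s | 0 < enorm (row_of_tuple s) <= 1].

Definition radial_projection (s : d.-tuple R) : d.-tuple R :=
  [tuple tnth s i / enorm (row_of_tuple s) | i < d].

Lemma measurable_enorm_tuple :
  measurable_fun setT (fun s : d.-tuple R => enorm (row_of_tuple s)).
Proof.
rewrite (_ : (fun _ => _) =
    fun s : d.-tuple R => Num.sqrt (\sum_(i < d) tnth s i ^+ 2)); last first.
  apply/funext => s; rewrite /enorm /dotv mxE; congr Num.sqrt.
  by apply: eq_bigr => i _; rewrite !mxE expr2.
have msqrt : measurable_fun setT (@Num.sqrt R).
  apply: continuous_measurable_fun; exact: sqrt_continuous.
apply: (measurableT_comp msqrt); apply: measurable_sum => i.
by apply: measurable_funX; exact: measurable_tnth.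
Qed.

Lemma measurable_punctured_ball : measurable punctured_ball.
Proof.
have := measurable_enorm_tuple measurableT (@measurable_itv R `]0, 1]).
by rewrite setTI.
Qed.

Lemma measurable_radial_projection : measurable_fun setT radial_projection.
Proof.
apply/measurable_fun_tnthP => i.
rewrite (_ : _ \o _ =
    fun s : d.-tuple R => tnth s i * enorm (row_of_tuple s) `^ (-1)); last first.
  by apply/funext => s /=; rewrite tnth_mktuple powR_inv1// sqrtr_ge0.
apply: measurable_funM; first exact: measurable_tnth.
exact: (measurableT_comp (@measurable_powR R (-1)) measurable_enorm_tuple).
Qed.

(* Surface area of A on the unit sphere of R^d is d times the volume of the cone
   {s | 0 < |s| <= 1, s/|s| in A}; equivalently, this is the measure given by
   integration in polar coordinates. *)
Definition sphere_measure (A : set (d.-tuple R)) : \bar R :=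
  (d%:R%:E * lebesgue_tuple R d (radial_projection @^-1` A `&` punctured_ball))%E.

Let nu : {measure set (d.-tuple R) -> \bar R} :=
  mscale d%:R%:nng
    (measure_function_pushforward__canonical__measure_function_Measure
       (mrestr (lebesgue_tuple R d) measurable_punctured_ball)
       measurable_radial_projection).

Let sphere0 : sphere_measure set0 = 0%E.
Proof. exact: (measure0 nu). Qed.

Let sphere_ge0 A : (0 <= sphere_measure A)%E.
Proof. exact: (measure_ge0 nu). Qed.

Let sphere_sigma_additive : semi_sigma_additive sphere_measure.
Proof. exact: (@measure_semi_sigma_additive _ _ _ nu). Qed.

HB.instance Definition _ := isMeasure.Build _ _ _ sphere_measure
  sphere0 sphere_ge0 sphere_sigma_additive.

End sphere_measure.

Section transforms.
Context {R : realType} {m : nat}.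
Implicit Types (tau zeta D : set 'rV[R]_m) (a : 'rV[R]_m).

(* (p, E) is an isometric chart s |-> p + s E of the d-plane tau, with p the
   point of tau nearest to the origin. *)
Definition is_chart d tau (F : 'rV[R]_m * 'M[R]_(d, m)) : Prop :=
  [/\ F.2 *m F.2^T = 1%:M, F.1 *m F.2^T = 0 &
      tau = [set F.1 + s *m F.2 | s in [set: 'rV[R]_d]]].

(* Any chart of tau gives the same integrals below: p is unique, and E is unique
   up to an orthogonal d x d matrix on its left. The value is junk when tau is
   not a d-plane. *)
Definition chart d tau : 'rV[R]_m * 'M[R]_(d, m) :=
  xget (0, 0) (is_chart tau).

(* The sphere [unit_sphere `&` zeta] has centre p and radius sqrt (1 - |p|^2);
   the factor r ^+ k.-1 rescales the surface area of the unit sphere. *)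
Definition parallel_slice k (f : 'rV[R]_m -> R) zeta : \bar R :=
  let: (p, E) := chart k zeta in
  let r := Num.sqrt (1 - enorm p ^+ 2) in
  let x (w : k.-tuple R) := p + (r *: row_of_tuple w) *m E in
  ((r ^+ k.-1)%:E *
   \int[@sphere_measure R k]_(w in [set w | unit_sphere (row_of_tuple w)])
      (f (x w))%:E)%E.

(* The Radon-John transform over d-planes of a function given on D. *)
Definition radon_john d D (phi : 'rV[R]_m -> R) tau : \bar R :=
  let: (p, E) := chart d tau in
  let x (s : d.-tuple R) := p + row_of_tuple s *m E in
  (\int[lebesgue_tuple R d]_(s in [set s | D (x s)]) (phi (x s))%:E)%E.

Definition hemisphere_fun a (f : 'rV[R]_m -> R) (y : 'rV[R]_m) : R :=
  2 * (Num.sqrt (1 - enorm y ^+ 2))^-1 *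
  f (y + Num.sqrt (1 - enorm y ^+ 2) *: unit_vector a).

End transforms.

(* Main.v *)
(* The slice is a sphere of centre u and radius r = sqrt (1 - |u|^2) in a plane
   spanned by a and an orthonormal basis G of the plane's intersection with the
   hyperplane orthogonal to a. Splitting that sphere into its two hemispheres on
   either side of the hyperplane and projecting each of them orthogonally gives
   [int_S F = int_{|s|<1} (F(q,s) + F(-q,s)) / q ds] with [q = sqrt (1 - |s|^2)],
   and the dilation s -> r s turns the right-hand side into r^(1-k) times the
   Radon-John transform, up to the factor r coming from 1/q.

   The surface area being defined by the volume of cones, the projection formula
   is a change of variables: in (t, y), t > 0, replace t by
   [rho = sqrt (t^2 + |y|^2)], exchange the integrals, and dilate y = rho s, so that
   the radial integral contributes [int_0^1 rho^d drho = 1/(d+1)]. That the charts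
   chosen for the two planes need not be compatible is harmless because Lebesgue
   measure, hence the surface area, is invariant under orthogonal matrices. *)

Require Import Defs.
From mathcomp Require Import all_boot all_order all_algebra.
From mathcomp Require Import all_classical all_reals all_analysis.
From mathcomp Require Import measurable_realfun ring.

Import Order.TTheory GRing.Theory Num.Theory.
Import numFieldNormedType.Exports.

Local Open Scope classical_set_scope.
Local Open Scope ring_scope.

(** * Lebesgue measure on tuples *)

Section affine.
Context {R : realType}.
Local Notation lam := (@lebesgue_measure R).

Let affine_map (r b : R) : measurableTypeR R -> measurableTypeR R :=
  fun t => r * t + b.

Let measurable_affine_map r b : measurable_fun setT (affine_map r b).
Proof. by apply: measurable_funD => //; exact: measurable_funM. Qed.

(** The image of [lam] under t -> r t + b, multiplied by r, gives every half-open interval its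
    length, so it is [lam]. *)
Lemma ge0_integral_lebesgue_affine (r b : R) (h : R -> \bar R) : 0 < r ->
  measurable_fun setT h -> (forall t, 0 <= h t)%E ->
  (\int[lam]_t h t = r%:E * \int[lam]_t h (r * t + b)%R)%E.
Proof.
move=> r0 mh h0.
pose nu : {measure set _ -> \bar R} := mscale (NngNum (ltW r0))
  (measure_function_pushforward__canonical__measure_function_Measure lam
    (measurable_affine_map r b)).
transitivity (\int[nu]_t h t)%E.
  apply: eq_measure_integral => A mA _.
  apply: lebesgue_measure_unique => //= _ [[x y]] _ <-.
  rewrite /mscale/= /pushforward.
  have -> : affine_map r b @^-1` `]x, y] = `](x - b) / r, (y - b) / r]%classic.
    apply/seteqP; split => t; rewrite /affine_map/= !in_itv/=;
    by rewrite ltr_pdivrMr// ler_pdivlMr// ltrBlDr lerBrDr mulrC.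
  rewrite !lebesgue_measure_itv/= !lte_fin ltr_pM2r ?invr_gt0// ltrD2r.
  case: ifPn => xy; last by rewrite mule0.
  rewrite -!EFinB -EFinM; congr EFin; field; exact: lt0r_neq0.
rewrite ge0_integral_mscale//=; congr (_ * _)%E.
by rewrite ge0_integral_pushforward.
Qed.

End affine.

Section tuples.
Context {R : realType}.
Local Notation lam := (@lebesgue_measure R).
Local Notation L := (@lebesgue_tuple R).

(** Tonelli with the head coordinate innermost, which is where the one-dimensional substitutions
    take place. *)
Lemma ge0_integral_lebesgue_tupleS d (h : d.+1.-tuple R -> \bar R) :
  measurable_fun setT h -> (forall x, 0 <= h x)%E ->
  (\int[L d.+1]_x h x = \int[L d]_s \int[lam]_t h (tuple_of_pair (t, s)))%E.
Proof.
move=> mh h0.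
rewrite (eq_measure_integral
  (measure_function_pushforward__canonical__measure_function_Measure
    (lam \x L d)%E (@measurable_tuple_of_pair R d)))//.
rewrite ge0_integral_pushforward//=; last exact: measurable_tuple_of_pair.
rewrite fubini_tonelli2//.
  exact: (measurableT_comp mh (@measurable_tuple_of_pair R d)).
Qed.

Lemma measurable_mktuple d0 (T : measurableType d0) d (f : 'I_d -> T -> R) :
  (forall i, measurable_fun setT (f i)) ->
  measurable_fun setT (fun x => [tuple f i x | i < d]).
Proof.
move=> mf; apply/measurable_fun_tnthP => i.
by rewrite (_ : _ \o _ = f i)//; apply/funext => x /=; rewrite tnth_mktuple.
Qed.

Definition tuple_affine d (r : R) (v s : d.-tuple R) : d.-tuple R :=
  [tuple r * tnth s i + tnth v i | i < d].

Lemma measurable_tuple_affine d r (v : d.-tuple R) :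
  measurable_fun setT (tuple_affine d r v).
Proof.
apply: measurable_mktuple => i; apply: measurable_funD => //.
by apply: measurable_funM => //; exact: measurable_tnth.
Qed.

Lemma tuple_affine_cons d r (v : d.+1.-tuple R) t (s : d.-tuple R) :
  tuple_affine d.+1 r v (tuple_of_pair (t, s)) =
  tuple_of_pair (r * t + thead v, tuple_affine d r [tuple of behead v] s).
Proof.
apply: eq_from_tnth => i; rewrite tnth_mktuple /tuple_of_pair/=.
case: (unliftP ord0 i) => [j|] ->; last by rewrite !tnth0.
rewrite !tnthS tnth_mktuple tnth_behead; congr (_ + tnth v _).
by apply: val_inj; rewrite [RHS]inordK ?ltnS ?ltn_ord.
Qed.

(** Induction on d: the head coordinate is substituted with the tail fixed, then the induction
    hypothesis is applied to the inner integral [k] as a function of the tail. *)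
Lemma ge0_integral_lebesgue_tuple_affine d (r : R) (v : d.-tuple R)
    (h : d.-tuple R -> \bar R) : 0 < r ->
  measurable_fun setT h -> (forall s, 0 <= h s)%E ->
  (\int[L d]_s h s = (r ^+ d)%:E * \int[L d]_s h (tuple_affine d r v s))%E.
Proof.
move=> r0; elim: d v h => [|d IH] v h mh h0.
  rewrite expr0 mul1e; apply: eq_integral => s _; congr h.
  by rewrite [LHS]tuple0 [RHS]tuple0.
have mha := measurableT_comp mh (measurable_tuple_affine _ r v).
rewrite !ge0_integral_lebesgue_tupleS//.
pose h' p := h (tuple_of_pair p).
have mh' : measurable_fun setT h'.
  exact: (measurableT_comp mh (@measurable_tuple_of_pair R d)).
have mh2 (s : d.-tuple R) : measurable_fun setT (fun t => h' (t, s)).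
  exact: (measurableT_comp mh' (@measurable_pair2 _ _ _ _ s)).
pose k (s : d.-tuple R) := (\int[lam]_t h' (r * t + thead v, s)%R)%E.
transitivity (\int[L d]_s (r%:E * k s))%E.
  apply: eq_integral => s _.
  by apply: (ge0_integral_lebesgue_affine r (thead v) (fun t => h' (t, s))) => // t; exact: h0.
have mk : measurable_fun setT k.
  apply: (measurable_fun_fubini_tonelli_G (m1 := lam)
    (fun p : R * d.-tuple R => h' (r * p.1 + thead v, p.2)%R)) => //.
    apply: (measurableT_comp mh'); apply: measurable_fun_pair => //.
    by apply: measurable_funD => //; apply: measurable_funM => //.
  by move=> ?; exact: h0.
have k0 s : (0 <= k s)%E by apply: integral_ge0 => *; exact: h0.
rewrite (ge0_integralZl (L d) measurableT mk (fun s _ => k0 s)); last first.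
  by rewrite lee_fin ltW.
rewrite (IH [tuple of behead v] k)// exprS EFinM -muleA; congr (_ * (_ * _))%E.
by apply: eq_integral => s _; apply: eq_integral => t _; rewrite tuple_affine_cons.
Qed.

Lemma enorm_row_of_tuple d (s : d.-tuple R) :
  enorm (row_of_tuple s) ^+ 2 = \sum_(i < d) tnth s i ^+ 2.
Proof.
rewrite /enorm /dotv mxE sqr_sqrtr; last first.
  by apply: sumr_ge0 => i _; rewrite !mxE -expr2 sqr_ge0.
by apply: eq_bigr => i _; rewrite !mxE expr2.
Qed.

Lemma enorm_row_of_tuple_cons d t (s : d.-tuple R) :
  enorm (row_of_tuple (tuple_of_pair (t, s))) ^+ 2 =
  t ^+ 2 + enorm (row_of_tuple s) ^+ 2.
Proof.
rewrite !enorm_row_of_tuple big_ord_recl tnth0; congr (_ + _).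
by apply: eq_bigr => i _; rewrite tnthS.
Qed.

Lemma measurable_gauss_tuple d : measurable_fun setT
  (fun s : d.-tuple R => (expR (- enorm (row_of_tuple s) ^+ 2))%:E).
Proof.
apply/measurable_EFinP; apply: measurableT_comp => //.
apply: measurable_funN; apply: measurable_funX.
exact: measurable_enorm_tuple.
Qed.

(** The Gaussian serves twice: its integral, finite and nonzero, cancels in the proof of orthogonal
    invariance, and it dominates the indicator of the unit ball when sphere integrals are shown to
    be finite. *)
Lemma integral_lebesgue_tuple_gauss d :
  (\int[L d]_s (expR (- enorm (row_of_tuple s) ^+ 2))%:E =
   (Num.sqrt pi ^+ d)%:E)%E.
Proof.
elim: d => [|d IH].
  rewrite integral_dirac//; last exact: measurable_gauss_tuple.
  by rewrite diracT mul1e enorm_row_of_tuple big_ord0 oppr0 expR0 expr0.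
have gauss_ge0 k (s : k.-tuple R) :
  (0 <= (expR (- enorm (row_of_tuple s) ^+ 2))%:E)%E by rewrite lee_fin expR_ge0.
rewrite (ge0_integral_lebesgue_tupleS _ _ (measurable_gauss_tuple _) (gauss_ge0 _)).
under eq_integral => s _.
  under eq_integral do rewrite enorm_row_of_tuple_cons opprD expRD mulrC EFinM.
  rewrite ge0_integralZl//; last by apply/measurable_EFinP; exact: measurable_gauss_fun.
  rewrite integralT_gauss muleC.
  over.
rewrite /= ge0_integralZl ?lee_fin ?sqrtr_ge0//; last exact: measurable_gauss_tuple.
by rewrite IH exprS.
Qed.

End tuples.

(** * Orthogonal invariance *)

Section rows.
Context {R : realType}.
Local Notation L := (@lebesgue_tuple R).

Definition tuple_of_row {d} (v : 'rV[R]_d) : d.-tuple R := [tuple v 0 i | i < d].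

Lemma tuple_of_rowK d : cancel (@tuple_of_row d) (@row_of_tuple R d).
Proof. by move=> v; apply/rowP => i; rewrite mxE tnth_mktuple. Qed.

Lemma tuple_affineE d r (v s : d.-tuple R) :
  tuple_affine d r v s = tuple_of_row (r *: row_of_tuple s + row_of_tuple v).
Proof. by apply: eq_from_tnth => i; rewrite !tnth_mktuple !mxE. Qed.

(** Coordinatewise measurability stands for measurability of row-valued maps; a function on rows is
    tested on tuples, through [row_of_tuple]. *)
Definition measurable_row {d0} {T : measurableType d0} {d} (f : T -> 'rV[R]_d) :=
  forall i, measurable_fun setT (fun x => f x 0 i).

Section measurable_row.
Context {d0} {T : measurableType d0} {d : nat}.
Implicit Types f g : T -> 'rV[R]_d.

Lemma measurable_tuple_of_row f :
  measurable_row f -> measurable_fun setT (fun x => tuple_of_row (f x)).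
Proof. by move=> mf; exact: (measurable_mktuple _ _ _ (fun i x => f x 0 i)). Qed.

Lemma measurable_row_of_tuple (f : T -> d.-tuple R) :
  measurable_fun setT f -> measurable_row (fun x => row_of_tuple (f x)).
Proof.
move=> mf i; rewrite [X in measurable_fun _ X](_ : _ = (fun x => tnth (f x) i)).
  exact: (measurableT_comp (@measurable_tnth _ _ _ i) mf).
by apply/funext => x; rewrite mxE.
Qed.

Lemma measurable_row_cst v : measurable_row (fun _ : T => v : 'rV[R]_d).
Proof. by move=> i; exact: measurable_cst. Qed.

Lemma measurable_rowD f g : measurable_row f -> measurable_row g ->
  measurable_row (fun x => f x + g x).
Proof.
move=> mf mg i; rewrite [X in measurable_fun _ X](_ : _ = (fun x => f x 0 i + g x 0 i)).
  exact: measurable_funD.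
by apply/funext => x; rewrite mxE.
Qed.

Lemma measurable_rowZ (r : T -> R) f : measurable_fun setT r ->
  measurable_row f -> measurable_row (fun x => r x *: f x).
Proof.
move=> mr mf i; rewrite [X in measurable_fun _ X](_ : _ = (fun x => r x * f x 0 i)).
  exact: measurable_funM.
by apply/funext => x; rewrite mxE.
Qed.

Lemma measurable_row_mulmx m f (A : 'M[R]_(d, m)) : measurable_row f ->
  measurable_row (fun x => f x *m A).
Proof.
move=> mf i.
rewrite [X in measurable_fun _ X](_ : _ = (fun x => \sum_j f x 0 j * A j i)).
  by apply: measurable_sum => j; exact: measurable_funM.
by apply/funext => x; rewrite mxE.
Qed.

Lemma measurable_enorm_row f : measurable_row f ->
  measurable_fun setT (fun x => enorm (f x)).
Proof.
move=> mf; have := measurableT_comp (@measurable_enorm_tuple R d)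
  (measurable_tuple_of_row _ mf).
by congr measurable_fun; apply/funext => x /=; rewrite tuple_of_rowK.
Qed.

End measurable_row.

Lemma measurable_comp_row d0 (T : measurableType d0) {d} d1 (U : measurableType d1)
    (h : 'rV[R]_d -> U) (f : T -> 'rV[R]_d) :
  measurable_fun setT (h \o @row_of_tuple R d) -> measurable_row f ->
  measurable_fun setT (fun x => h (f x)).
Proof.
move=> mh mf; have := measurableT_comp mh (measurable_tuple_of_row _ mf).
by congr measurable_fun; apply/funext => x /=; rewrite tuple_of_rowK.
Qed.

Lemma enorm_mulmx {d m} (v : 'rV[R]_d) (A : 'M[R]_(d, m)) :
  A *m A^T = 1%:M -> enorm (v *m A) = enorm v.
Proof.
by move=> AA; rewrite /enorm /dotv trmx_mul mulmxA -(mulmxA v) AA mulmx1.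
Qed.

Section change_of_variables.
Context {d : nat} (h : 'rV[R]_d -> \bar R).
Hypothesis mh : measurable_fun setT (h \o @row_of_tuple R d).
Hypothesis h0 : forall v, (0 <= h v)%E.

Lemma ge0_integral_lebesgue_tuple_scale r (v : 'rV[R]_d) : 0 < r ->
  (\int[L d]_s h (row_of_tuple s) =
   (r ^+ d)%:E * \int[L d]_s h (r *: row_of_tuple s + v)%R)%E.
Proof.
move=> r0.
rewrite (ge0_integral_lebesgue_tuple_affine d r (tuple_of_row v) _ r0 mh)//.
  by congr (_ * _)%E; apply: eq_integral => s _;
    rewrite /= tuple_affineE !tuple_of_rowK.
by move=> s; exact: h0.
Qed.

Lemma ge0_integral_lebesgue_tuple_translate (v : 'rV[R]_d) :
  (\int[L d]_s h (row_of_tuple s) = \int[L d]_s h (row_of_tuple s + v)%R)%E.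
Proof.
rewrite (ge0_integral_lebesgue_tuple_scale 1 v ltr01) expr1n mul1e.
by apply: eq_integral => s _; rewrite scale1r.
Qed.

End change_of_variables.

(* Translating x and y in turn gives, with G the Gaussian,
   [int int G(x) h(y O) = int int G(x + y O) h(y O) = int int G(y O) h(y O - x)],
   and G(y O) = G(y). *)
Lemma ge0_integral_lebesgue_tuple_orthogonalN d (h : 'rV[R]_d -> \bar R)
    (O : 'M[R]_d) : O *m O^T = 1%:M ->
  measurable_fun setT (h \o @row_of_tuple R d) -> (forall v, 0 <= h v)%E ->
  (\int[L d]_s h (row_of_tuple s *m O) = \int[L d]_s h (- row_of_tuple s)%R)%E.
Proof.
move=> OO mh h0.
have O'O : O^T *m O = 1%:M by exact: mulmx1C.
pose G (v : 'rV[R]_d) := (expR (- enorm v ^+ 2))%:E.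
have G0 v : (0 <= G v)%E by rewrite lee_fin expR_ge0.
have mG : measurable_fun setT (G \o @row_of_tuple R d).
  exact: measurable_gauss_tuple.
have mrow1 : measurable_row (fun s : d.-tuple R => row_of_tuple s).
  exact: measurable_row_of_tuple.
pose c := (\int[L d]_s G (row_of_tuple s))%E.
have cE : c = (Num.sqrt pi ^+ d)%:E by exact: integral_lebesgue_tuple_gauss.
have c_neq0 : (Num.sqrt pi ^+ d : R) != 0.
  by rewrite expf_neq0// gt_eqF// sqrtr_gt0 pi_gt0.
have c0 : (0 <= c)%E by rewrite cE lee_fin exprn_ge0// sqrtr_ge0.
have intZl (k : d.-tuple R -> \bar R) x : measurable_fun setT k ->
    (forall s, 0 <= k s)%E -> (0 <= x)%E ->
    (\int[L d]_s (x * k s) = x * \int[L d]_s k s)%E.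
  by move=> mk k0 x0; apply: ge0_integralZl.
have intZr (k : d.-tuple R -> \bar R) x : measurable_fun setT k ->
    (forall s, 0 <= k s)%E -> (0 <= x)%E ->
    (\int[L d]_s (k s * x) = (\int[L d]_s k s) * x)%E.
  by move=> mk k0 x0; apply: ge0_integralZr.
pose X := (\int[L d]_y \int[L d]_x
  (G (row_of_tuple x + row_of_tuple y *m O)%R * h (row_of_tuple y *m O)))%E.
have X1 : X = (c * \int[L d]_s h (row_of_tuple s *m O))%E.
  rewrite -intZl//; last by apply: measurable_comp_row => //; exact: measurable_row_mulmx.
  apply: eq_integral => y _.
  rewrite intZr; last 3 first.
  - by apply: measurable_comp_row => //; exact: measurable_rowD.
  - by move=> ?; exact: G0.
  - exact: h0.
  by rewrite -(ge0_integral_lebesgue_tuple_translate G mG G0 (row_of_tuple y *m O)).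
have X2 : X = (c * \int[L d]_s h (- row_of_tuple s)%R)%E.
  rewrite /X (fubini_tonelli (m1 := L d) (m2 := L d) (fun p : d.-tuple R * d.-tuple R =>
    G (row_of_tuple p.2 + row_of_tuple p.1 *m O)%R *
    h (row_of_tuple p.1 *m O)))%E//=; last 2 first.
  - apply: emeasurable_funM; apply: measurable_comp_row => //.
      apply: measurable_rowD; first exact: measurable_row_of_tuple.
      by apply: measurable_row_mulmx; exact: measurable_row_of_tuple.
    by apply: measurable_row_mulmx; exact: measurable_row_of_tuple.
  - by move=> p; rewrite mule_ge0.
  transitivity (\int[L d]_x \int[L d]_y
    (G (row_of_tuple y) * h (row_of_tuple y *m O - row_of_tuple x)%R))%E.
    apply: eq_integral => x _.
    rewrite (ge0_integral_lebesgue_tuple_translate (fun v =>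
      G (row_of_tuple x + v *m O)%R * h (v *m O))%E _ _
      (- (row_of_tuple x *m O^T))); last 2 first.
    - apply: emeasurable_funM; apply: measurable_comp_row => //.
        apply: measurable_rowD; first exact: (measurable_row_cst).
        exact: measurable_row_mulmx.
      exact: measurable_row_mulmx.
    - by move=> v; rewrite mule_ge0.
    apply: eq_integral => y _; rewrite mulmxDl mulNmx -mulmxA O'O mulmx1 addrC subrK.
    by rewrite /G enorm_mulmx.
  rewrite (fubini_tonelli (m1 := L d) (m2 := L d) (fun p : d.-tuple R * d.-tuple R =>
    G (row_of_tuple p.2) * h (row_of_tuple p.2 *m O - row_of_tuple p.1)%R))%E//=; last 2 first.
  - apply: emeasurable_funM; apply: measurable_comp_row => //.
      exact: measurable_row_of_tuple.
    apply: measurable_rowD.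
      by apply: measurable_row_mulmx; exact: measurable_row_of_tuple.
    under [X in measurable_row X]eq_fun do rewrite -scaleN1r.
    by apply: measurable_rowZ => //; exact: measurable_row_of_tuple.
  - by move=> p; rewrite mule_ge0.
  have mhN : measurable_fun setT (fun s : d.-tuple R => h (- row_of_tuple s)).
    apply: measurable_comp_row => //; under [X in measurable_row X]eq_fun do rewrite -scaleN1r.
    exact: measurable_rowZ.
  rewrite -intZr; last 3 first.
  - exact: mG.
  - by move=> ?; exact: G0.
  - by apply: integral_ge0 => s _; exact: h0.
  apply: eq_integral => y _; rewrite intZl; last 3 first.
  - apply: measurable_comp_row => //.
    apply: measurable_rowD; first exact: (measurable_row_cst).
    under [X in measurable_row X]eq_fun do rewrite -scaleN1r.
    exact: measurable_rowZ.
  - by move=> ?; exact: h0.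
  - exact: G0.
  congr (_ * _)%E.
  rewrite [RHS](ge0_integral_lebesgue_tuple_translate (fun v => h (- v)) mhN
    (fun v => h0 _) (- (row_of_tuple y *m O))).
  by apply: eq_integral => x _; rewrite opprD opprK addrC.
have : (c * \int[L d]_s h (row_of_tuple s *m O) = c * \int[L d]_s h (- row_of_tuple s)%R)%E.
  by rewrite -X1 -X2.
(* The Gaussian integral is a nonzero real, so it cancels even when the integrals of [h] are
   infinite. *)
move/(congr1 (mule (Num.sqrt pi ^+ d)^-1%:E)).
by rewrite cE !muleA -EFinM mulVf// !mul1e.
Qed.

(** The sign left over by the translations is the same for every orthogonal matrix, so comparison
    with the identity removes it. *)
Lemma ge0_integral_lebesgue_tuple_orthogonal d (h : 'rV[R]_d -> \bar R)
    (O : 'M[R]_d) : O *m O^T = 1%:M ->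
  measurable_fun setT (h \o @row_of_tuple R d) -> (forall v, 0 <= h v)%E ->
  (\int[L d]_s h (row_of_tuple s *m O) = \int[L d]_s h (row_of_tuple s))%E.
Proof.
move=> OO mh h0; rewrite ge0_integral_lebesgue_tuple_orthogonalN//.
rewrite -(ge0_integral_lebesgue_tuple_orthogonalN d h 1%:M)//; last first.
  by rewrite trmx1 mulmx1.
by apply: eq_integral => s _; rewrite mulmx1.
Qed.

End rows.

(** * The substitution rho = sqrt (t^2 + c^2) *)

Lemma ge0_integral_mrestr d (T : measurableType d) (R : realType)
    (mu : {measure set T -> \bar R}) (D : set T) (mD : measurable D)
    (f : T -> \bar R) : measurable_fun setT f -> (forall x, 0 <= f x)%E ->
  (\int[mrestr mu mD]_x f x = \int[mu]_(x in D) f x)%E.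
Proof.
move=> mf f0.
rewrite (ge0_negligible_integral (measurableC mD) measurableT)//.
  rewrite setTD setCK; apply: eq_measure_integral => A mA AD.
  by rewrite /= /mrestr setIidl.

rewrite -[LHS]/(mu (~` D `&` D)) setICl measure0 //.
Qed.

Section hyperbolic_substitution.
Context {R : realType}.
Local Notation lam := (@lebesgue_measure R).
Variable c : R.

Let phi (t : R) := Num.sqrt (t ^+ 2 + c ^+ 2).
Let G (t : R) := t / phi t.

Let phi_neq0 t : 0 < c -> 0 < phi t.
Proof. by move=> c0; rewrite sqrtr_gt0 ltr_wpDl ?sqr_ge0// exprn_gt0. Qed.

Let continuous_phi : continuous phi.
Proof.
move=> t; apply: continuous_comp; last exact: sqrt_continuous.
by apply: cvgD; [exact: exprn_continuous|exact: cvg_cst].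
Qed.

Let continuous_G : 0 < c -> continuous G.
Proof.
move=> c0 t; apply: cvgM; first exact: cvg_id.
by apply: cvgV; [rewrite gt_eqF// phi_neq0|exact: continuous_phi].
Qed.

Let is_derive_phi (t : R) : 0 < c -> is_derive t 1 phi (G t).
Proof.
move=> c0.
have p0 : 0 < t ^+ 2 + c ^+ 2 by rewrite ltr_wpDl ?sqr_ge0// exprn_gt0.
have d1 : is_derive t 1 (fun x : R => x ^+ 2 + c ^+ 2) (2 * t).
  by apply: is_derive_eq; rewrite addr0 mulrDl !mul1r; congr (_ + _); exact: mulr1.
have d2 : is_derive (t ^+ 2 + c ^+ 2) 1 Num.sqrt (2 * Num.sqrt (t ^+ 2 + c ^+ 2))^-1.
  exact: is_derive1_sqrt.
have := @is_derive1_comp _ Num.sqrt (fun x : R => x ^+ 2 + c ^+ 2) t _ _ d2 d1.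
by move=> /is_derive_eq; apply; rewrite /G /phi invfM mulrACA mulVf// mul1r mulrC.
Qed.

Lemma integral_hyperbolic x y : 0 < c -> 0 <= x -> x <= y ->
  (\int[lam]_(t in `]x, y]) (G t)%:E = (phi y - phi x)%:E)%E.
Proof.
move=> c0 x0; rewrite le_eqVlt => /predU1P[->|xy].
  by rewrite set_itv_ge ?bnd_simp ?ltxx// integral_set0 subrr.
rewrite integral_itv_obnd_cbnd; last first.
  apply/measurable_EFinP; apply: measurable_funTS => //.
  by apply: continuous_measurable_fun; exact: continuous_G.
rewrite (continuous_FTC2 (F := phi) xy)//.
- exact/continuous_subspaceT/continuous_G.
- split.
  + by move=> t _; apply: ex_derive; exact: is_derive_phi.
  + exact/cvg_at_right_filter/continuous_phi.
  + exact/cvg_at_left_filter/continuous_phi.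
- by move=> t _; rewrite derive1E; apply: derive_val; exact: is_derive_phi.
Qed.

Hypothesis c_gt0 : 0 < c.

Let measurable_phi : measurable_fun setT phi.
Proof. exact: continuous_measurable_fun. Qed.

Let measurable_G : measurable_fun setT G.
Proof. by apply: continuous_measurable_fun; exact: continuous_G. Qed.

Let D : set (R * R) := [set p | 0 < p.1] `&` [set p | 0 <= p.2] `&` [set p | p.2 < G p.1].

Let mD : measurable D.
Proof.
have mset (b : R * R -> bool) : measurable_fun setT b -> measurable [set p | b p].
  by move=> mb; rewrite -[X in measurable X]setTI; exact: (mb measurableT [set true]).
apply: measurableI; first apply: measurableI; apply: mset.
- exact: measurable_fun_ltr.
- exact: measurable_fun_ler.
- by apply: measurable_fun_ltr => //; exact: (measurableT_comp measurable_G).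
Qed.

Let psi (p : R * R) : measurableTypeR R := phi p.1.

Let measurable_psi : measurable_fun setT psi.
Proof. exact: (measurableT_comp measurable_phi). Qed.

(* The measure of density [G] pushed forward by [phi], the density being
   encoded by integration over the hypograph of [G]. *)
Let Lam : {measure set (measurableTypeR R) -> \bar R} :=
  measure_function_pushforward__canonical__measure_function_Measure
    (mrestr (lam \x lam)%E mD) measurable_psi.

(** Tonelli: the section of [D] over t > 0 is the interval [0, G t[, of length G t, and over t <= 0
    it is empty. *)
Let ge0_integral_Lam (h : R -> \bar R) : measurable_fun setT h ->
  (forall x, 0 <= h x)%E ->
  (\int[Lam]_x h x = \int[lam]_(t in `]0%R, +oo[) ((G t)%:E * h (phi t)))%E.
Proof.
move=> mh h0.
rewrite ge0_integral_pushforward//= ge0_integral_mrestr//; last first.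
  exact: (measurableT_comp mh measurable_psi).
rewrite integral_mkcond fubini_tonelli1; last 2 first.
- by apply/(measurable_restrictT _ _).1 => //; apply: measurable_funTS;
    exact: (measurableT_comp mh measurable_psi).
- by move=> p; rewrite patchE; case: ifP => // _; exact: h0.
rewrite [RHS]integral_mkcond; apply: eq_integral => t _.
rewrite patchE mem_setE in_itv/= andbT /fubini_F; case: ifPn => t0; last first.
  rewrite integral0_eq// => z _; rewrite patchE memNset// => -[[/=]].
  by rewrite (negbTE t0).
have G0 : 0 <= G t by rewrite divr_ge0 ?ltW// phi_neq0.
transitivity (\int[lam]_(z in `[0%R, G t[) cst (h (phi t)) z)%E.
  rewrite [RHS]integral_mkcond; apply: eq_integral => z _; rewrite !patchE.
  rewrite mem_setE in_itv/=; congr (if _ then _ else _).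
  apply/idP/idP => [/set_mem[[]]/= _ -> ->//|/andP[z0 zG]].
  by apply/mem_set; split => //.
rewrite integral_cst//= lebesgue_measure_itv/= lte_fin muleC.
by case: ltP => [|G1]; rewrite ?oppr0 ?adde0// (@le_anti _ _ (G t) 0) ?G1.
Qed.

(** On t > 0, [phi] increases from c to infinity. The square root on the right is its inverse, and
    the maximum with c extends it by 0 to x <= c. *)
Let phi_lt x t : 0 < t -> (x < phi t) = (Num.sqrt (Num.max x c ^+ 2 - c ^+ 2) < t).
Proof.
move=> t0.
have ct : c < phi t.
  by rewrite -[ltLHS]gtr0_norm// -sqrtr_sqr ltr_sqrt ?ltrDr ?addr_gt0 ?exprn_gt0.
have -> : (x < phi t) = (Num.max x c < phi t) by rewrite gt_max ct andbT.
have m0 : 0 <= Num.max x c by rewrite le_max (ltW c_gt0) orbT.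
rewrite -(ltr_pXn2r (n := 2)) ?nnegrE ?sqrtr_ge0//.
rewrite sqr_sqrtr ?addr_ge0 ?sqr_ge0// -ltrBlDr.
rewrite -[in RHS](ltr_pXn2r (n := 2)) ?nnegrE ?sqrtr_ge0 ?(ltW t0)//.
by rewrite sqr_sqrtr// subr_ge0 ler_pXn2r ?nnegrE ?(ltW c_gt0)// le_max lexx orbT.
Qed.

Let phi_max x : phi (Num.sqrt (Num.max x c ^+ 2 - c ^+ 2)) = Num.max x c.
Proof.
have m0 : 0 <= Num.max x c by rewrite le_max (ltW c_gt0) orbT.
rewrite /phi sqr_sqrtr ?subrK ?sqrtr_sqr ?ger0_norm//.
by rewrite subr_ge0 ler_pXn2r ?nnegrE ?(ltW c_gt0)// le_max lexx orbT.
Qed.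

(** Within t > 0, the preimage of ]x, y] under [phi] is ]q x, q y]. Integrating [G], the derivative
    of [phi], over it gives max(y, c) - max(x, c). *)
Let Lam_itv x y : x < y ->
  Lam `]x, y]%classic = lam (`]x, y] `&` `]c, +oo[)%classic.
Proof.
move=> xy.
pose q z := Num.sqrt (Num.max z c ^+ 2 - c ^+ 2).
have mxy : Num.max x c <= Num.max y c by rewrite ge_max !le_max (ltW xy) lexx orbT.
have m0 z : 0 <= Num.max z c by rewrite le_max (ltW c_gt0) orbT.
have qxy : q x <= q y by rewrite ler_wsqrtr// lerD2r ler_pXn2r ?nnegrE.
transitivity (\int[Lam]_t (\1_`]x, y] t)%:E)%E.
  by rewrite integral_indic// setIT.
rewrite ge0_integral_Lam//; last first.
  by apply/measurable_EFinP; exact: measurable_indic.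
transitivity (\int[lam]_(t in `]q x, q y]) (G t)%:E)%E.
  rewrite [LHS]integral_mkcond [RHS]integral_mkcond.
  apply: eq_integral => t _; rewrite !patchE !mem_setE !in_itv/= andbT.
  have [t0|t0] := ltP 0 t; last first.
    by rewrite ltNge (le_trans t0) ?sqrtr_ge0.
  rewrite indicE mem_setE in_itv/= phi_lt// leNgt phi_lt// -leNgt -/(q x) -/(q y).
  by case: ifP => _; rewrite ?mule1 ?mule0.
rewrite integral_hyperbolic ?sqrtr_ge0// !phi_max.
have -> : (`]x, y] `&` `]c, +oo[)%classic = `]Num.max x c, Num.max y c]%classic.
  apply/seteqP; split => t /=; rewrite !in_itv/= andbT gt_max le_max.
    by move=> [/andP[-> ->] ->].
  move=> /andP[/andP[-> ct]]; rewrite (leNgt t c) ct orbF => ->.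
  by split.
rewrite lebesgue_measure_itv/= lte_fin -EFinB; case: ifPn => // m.
suff -> : Num.max y c = Num.max x c by rewrite subrr.
by apply/le_anti; rewrite mxy leNgt m.
Qed.

(** Uniqueness of measures: half-open intervals are stable under intersection, and the intervals
    ]-k, k] exhaust the line with finite mass. *)
Let LamE A : measurable A ->
  Lam A = mrestr lam (measurable_itv `]c, +oo[) A.
Proof.
apply: (@measure_unique _ R (measurableTypeR R) (@ocitv R)
  (fun k => `]- (k%:R), k%:R]%classic)) => //.
- exact: ocitvI.
- by move=> k; apply: is_ocitv.
- apply/seteqP; split => // x _; exists (Num.truncn `|x|).+1 => //=.
  have := truncnS_gt `|x|; rewrite in_itv/= ltr_norml => /andP[-> /ltW ->].
  by [].
- by move=> X /ocitvP[->|[[x y] /= xy ->]]; [rewrite !measure0|exact: Lam_itv].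
(* For k = 0 the interval is empty, a case that [Lam_itv] does not cover. *)
- case=> [|k]; first by rewrite oppr0 set_itv_ge ?bnd_simp ?ltxx// measure0.
  rewrite Lam_itv; last by rewrite (@lt_trans _ _ 0)// oppr_lt0.
  rewrite (@le_lt_trans _ _ (lam `]- (k.+1%:R), k.+1%:R]%classic))//.
    by rewrite le_measure ?inE//; exact: measurableI.
  by rewrite lebesgue_measure_itv/= lte_fin; case: ifP; rewrite ?ltry.
Qed.

Lemma integral_hyperbolic_substitution_gt0 (h : R -> \bar R) :
  measurable_fun setT h -> (forall x, 0 <= h x)%E ->
  (forall x, x <= c -> h x = 0%E) ->
  (\int[lam]_x h x = \int[lam]_(t in `]0%R, +oo[) ((G t)%:E * h (phi t)))%E.
Proof.
move=> mh h0 hc; rewrite -ge0_integral_Lam// [RHS](eq_measure_integral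
  (mrestr lam (measurable_itv `]c, +oo[))); last by move=> A mA _; exact: LamE.
rewrite ge0_integral_mrestr// [RHS]integral_mkcond.
apply: eq_integral => x _; rewrite patchE mem_setE in_itv/= andbT.
by case: ltP => // /hc.
Qed.

End hyperbolic_substitution.

(** In the application c is a norm, so c = 0 has to be allowed: there phi t = t for t > 0 and the
    weight is 1. On t > 0 the values of phi exceed c, whence the vanishing condition on [h]. *)
Lemma integral_hyperbolic_substitution {R : realType} (c : R) (h : R -> \bar R) :
  0 <= c -> measurable_fun setT h -> (forall x, 0 <= h x)%E ->
  (forall x, x <= c -> h x = 0%E) ->
  let phi t := Num.sqrt (t ^+ 2 + c ^+ 2) in
  (\int[lebesgue_measure]_x h x =
   \int[lebesgue_measure]_(t in `]0%R, +oo[) ((t / phi t)%:E * h (phi t)))%E.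
Proof.
rewrite le_eqVlt => /predU1P[<-|c0] mh h0 hc /=; last first.
  exact: integral_hyperbolic_substitution_gt0.
rewrite [LHS](_ : _ = \int[lebesgue_measure]_(x in `]0%R, +oo[) h x)%E.
  apply: eq_integral => t; rewrite inE/= in_itv/= andbT => t0.
  by rewrite expr0n addr0 sqrtr_sqr gtr0_norm// divff ?mul1e// gt_eqF.
rewrite [RHS]integral_mkcond; apply: eq_integral => x _.
rewrite patchE mem_setE in_itv/= andbT.
by case: ltP => // /hc.
Qed.

(** * Integration over the sphere *)

Section measurability.
Context d0 (T : measurableType d0) (R : realType).

(** The identity 1/y = y (y^2)^-1 reduces inversion to a power with nonnegative base; at 0 both
    sides are 0 by convention. *)
Lemma measurable_funV (f : T -> R) :
  measurable_fun setT f -> measurable_fun setT (fun x => (f x)^-1).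
Proof.
move=> mf; rewrite [X in measurable_fun _ X](_ : _ =
    fun x => f x * (f x ^+ 2) `^ (-1)).
  apply: measurable_funM => //; apply: (measurableT_comp (measurable_powR (-1))).
  exact: measurable_funX.
apply/funext => x; rewrite powR_inv1 ?sqr_ge0//.
by have [->|x0] := eqVneq (f x) 0; [rewrite invr0 mul0r|rewrite expr2 invfM mulVKf].
Qed.

Lemma measurable_fun_sqrt (f : T -> R) :
  measurable_fun setT f -> measurable_fun setT (fun x => Num.sqrt (f x)).
Proof.
move=> mf; apply: measurableT_comp mf.
by apply: continuous_measurable_fun; exact: sqrt_continuous.
Qed.

Lemma measurable_fun_natb (b : T -> bool) :
  measurable_fun setT b -> measurable_fun setT (fun x => (b x)%:R : R).
Proof. exact: (measurableT_comp (f := fun b : bool => b%:R : R)). Qed.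

End measurability.

Lemma ge0_integral_lebesgue_sym {R : realType} (h : R -> \bar R) :
  measurable_fun setT h -> (forall x, 0 <= h x)%E ->
  (\int[lebesgue_measure]_x h x =
   \int[lebesgue_measure]_(t in `]0%R, +oo[) (h t + h (- t)%R))%E.
Proof.
move=> mh h0.
have mhN : measurable_fun setT (fun t : R => h (- t)).
  by apply: (measurableT_comp mh); exact: measurable_funN.
rewrite ge0_integralD//; first last.
- exact: measurable_funTS.
- exact: measurable_funTS.
(* Adding the null point 0 lets the reflected half-line ]-oo, 0] complete ]0, +oo[ to the whole
   line. *)
rewrite [X in (_ + X)%E]integral_itv_obnd_cbnd; last exact: measurable_funTS.
rewrite [X in (_ + X)%E]ge0_integration_by_substitution0//.
under [X in (_ + X)%E]eq_integral do rewrite opprK.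
rewrite addeC -ge0_integral_setU//=.
- congr integral; apply/seteqP; split => // x _ /=; rewrite !in_itv/= andbT.
  by case: (ltP 0 x); [right|left].
- exact: measurable_funTS.
- apply/disj_setPS => x [] /=; rewrite !in_itv/= andbT => x0.
  by rewrite ltNge x0.
Qed.

(** The radial integral, whose value cancels the dimension factor in [sphere_measure]. *)
Lemma integral_expr01 {R : realType} d :
  (\int[lebesgue_measure]_(x in `]0%R, 1%R]) (x ^+ d)%:E = (d.+1%:R^-1 : R)%:E)%E.
Proof.
rewrite integral_itv_obnd_cbnd; last first.
  apply/measurable_EFinP; apply: measurable_funTS; exact: measurable_funX.
have cX n : continuous (fun x : R => x ^+ n) by exact: exprn_continuous.
pose F (x : R) := d.+1%:R^-1 * x ^+ d.+1.
have cF : continuous F by move=> x; apply: cvgM; [exact: cvg_cst|exact: cX].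
have dF (x : R) : is_derive x 1 F (x ^+ d).
  apply: DeriveDef; first by apply: derivableZ; exact: exprn_derivable.
  rewrite (@deriveZ _ _ _ (fun x : R => x ^+ d.+1)); last exact: exprn_derivable.
  by rewrite exp_derive /GRing.scale/= mulr1 mulrA mulVf ?mul1r// pnatr_eq0.
rewrite (continuous_FTC2 (F := F))//.
- by rewrite /F expr1n expr0n mulr0 mulr1 sube0.
- exact/continuous_subspaceT.
- split.
  + by move=> t _; apply: ex_derive; exact: dF.
  + exact/cvg_at_right_filter/cF.
  + exact/cvg_at_left_filter/cF.
- by move=> t _; rewrite derive1E; apply: derive_val; exact: dF.
Qed.

Lemma dotvE {R : realType} {m} (x y : 'rV[R]_m) :
  dotv x y = \sum_i x 0 i * y 0 i.
Proof. by rewrite /dotv mxE; apply: eq_bigr => i _; rewrite mxE. Qed.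

Lemma dotv_ge0 {R : realType} {m} (x : 'rV[R]_m) : 0 <= dotv x x.
Proof. by rewrite dotvE sumr_ge0// => i _; rewrite -expr2 sqr_ge0. Qed.

Lemma enorm_sqr {R : realType} {m} (x : 'rV[R]_m) : enorm x ^+ 2 = dotv x x.
Proof. by rewrite sqr_sqrtr// dotv_ge0. Qed.

Lemma enorm_ge0 {R : realType} {m} (x : 'rV[R]_m) : 0 <= enorm x.
Proof. exact: sqrtr_ge0. Qed.

Lemma enormZ {R : realType} {m} (r : R) (x : 'rV[R]_m) :
  enorm (r *: x) = `|r| * enorm x.
Proof.
have -> : enorm (r *: x) = Num.sqrt (r ^+ 2 * dotv x x).
  congr Num.sqrt; rewrite !dotvE big_distrr/=.
  by apply: eq_bigr => i _; rewrite !mxE; ring.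
by rewrite sqrtrM ?sqr_ge0// sqrtr_sqr.
Qed.

Section row_cons.
Context {R : realType} {d : nat}.

(** The block form lets a product with [col_mx a G] split into t a + v G. *)
Definition row_cons (t : R) (v : 'rV[R]_d) : 'rV[R]_d.+1 :=
  row_mx (t%:M : 'M[R]_1) v.

Lemma row_cons0 t v : row_cons t v 0 ord0 = t.
Proof. by rewrite mxE; case: splitP => // j _; rewrite mxE ord1 eqxx mulr1n. Qed.

Lemma row_consS t v i : row_cons t v 0 (lift ord0 i) = v 0 i.
Proof.
rewrite mxE; case: splitP => [j|j /= [ij]]; first by rewrite ord1.
by congr (v _ _); exact: val_inj.
Qed.

Lemma row_of_tuple_cons t (s : d.-tuple R) :
  row_of_tuple (tuple_of_pair (t, s)) = row_cons t (row_of_tuple s).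
Proof.
apply/rowP => i; rewrite mxE; case: (unliftP ord0 i) => [j|] ->.
  by rewrite row_consS tnthS mxE.
by rewrite row_cons0 tnth0.
Qed.

Lemma scale_row_cons r t v : r *: row_cons t v = row_cons (r * t) (r *: v).
Proof. by rewrite /row_cons -scale_scalar_mx -scale_row_mx. Qed.

Lemma enorm_row_cons t v : enorm (row_cons t v) = Num.sqrt (t ^+ 2 + enorm v ^+ 2).
Proof.
rewrite {1}/enorm enorm_sqr !dotvE big_ord_recl row_cons0 expr2.
by congr (Num.sqrt (_ + _)); apply: eq_bigr => i _; rewrite row_consS.
Qed.

Lemma measurable_row_cons d0 (T : measurableType d0) (f : T -> R) (g : T -> 'rV[R]_d) :
  measurable_fun setT f -> measurable_row g ->
  measurable_row (fun x => row_cons (f x) (g x)).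
Proof.
move=> mf mg i; case: (unliftP ord0 i) => [j|] ->.
  by under eq_fun do rewrite row_consS; exact: mg.
by under eq_fun do rewrite row_cons0.
Qed.

End row_cons.

Section sphere.
Context {R : realType}.
Local Notation lam := (@lebesgue_measure R).
Local Notation L := (@lebesgue_tuple R).

Lemma measurable_cone d0 (T : measurableType d0) {d} (F : 'rV[R]_d -> R)
    (f : T -> 'rV[R]_d) :
  measurable_fun setT (F \o @row_of_tuple R d) -> measurable_row f ->
  measurable_fun setT (fun x =>
    ((0 < enorm (f x) <= 1)%R%:R * F ((enorm (f x))^-1 *: f x))%:E).
Proof.
move=> mF mf; have me := measurable_enorm_row _ mf.
apply/measurable_EFinP; apply: measurable_funM.
  apply: measurable_fun_natb; apply: measurable_and.
    exact: measurable_fun_ltr.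
  exact: measurable_fun_ler.
apply: (measurable_comp_row _ _ _ _ F _ mF).
by apply: measurable_rowZ => //; exact: measurable_funV.
Qed.

Definition sphere_set d : set (d.-tuple R) :=
  [set w | unit_sphere (row_of_tuple w)].

Lemma measurable_sphere_set d : measurable (sphere_set d).
Proof.
have := @measurable_enorm_tuple R d measurableT _ (measurable_set1 1).
by rewrite setTI.
Qed.

(** Surface area is d times the image of Lebesgue measure on the punctured ball under radial
    projection. The projected points lie on the sphere, so restricting to [sphere_set d] changes
    nothing. *)
Lemma ge0_integral_sphere_measure d (F : 'rV[R]_d -> R) :
  measurable_fun setT (F \o @row_of_tuple R d) -> (forall v, 0 <= F v) ->
  (\int[@sphere_measure R d]_(w in sphere_set d) (F (row_of_tuple w))%:E =
   d%:R%:E * \int[L d]_s ((0 < enorm (row_of_tuple s) <= 1)%R%:R *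
     F ((enorm (row_of_tuple s))^-1 *: row_of_tuple s))%R%:E)%E.
Proof.
move=> mF F0.
have mFE : measurable_fun setT (fun w : d.-tuple R => (F (row_of_tuple w))%:E).
  exact/measurable_EFinP.
pose FS := (fun w => (F (row_of_tuple w))%:E) \_ (sphere_set d).
have mFS : measurable_fun setT FS.
  apply/(measurable_restrictT _ _).1; first exact: measurable_sphere_set.
  exact: measurable_funTS.
have FS0 w : (0 <= FS w)%E.
  by rewrite /FS patchE; case: ifP => // _; rewrite lee_fin.
rewrite integral_mkcond -/FS.
transitivity (\int[mscale (d%:R%:nng)%R
  (measure_function_pushforward__canonical__measure_function_Measure
    (mrestr (L d) (@measurable_punctured_ball R d))
      (@measurable_radial_projection R d))]_w FS w)%E.
  exact: eq_measure_integral.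
rewrite ge0_integral_mscale//= ge0_integral_pushforward//=; last first.
  exact: measurable_radial_projection.
rewrite ge0_integral_mrestr//; last first.
  by apply: (measurableT_comp mFS); exact: measurable_radial_projection.
congr (_ * _)%E; rewrite integral_mkcond; apply: eq_integral => s _.
rewrite patchE; case: ifPn => [/set_mem/= s1|/negP s1]; last first.
  rewrite (_ : (_ < _ <= _) = false) ?mul0r//; apply/negP => s2.
  by apply: s1; apply/mem_set.
have rE : row_of_tuple (radial_projection s) =
    (enorm (row_of_tuple s))^-1 *: row_of_tuple s.
  by apply/rowP => i; rewrite !mxE tnth_mktuple mulrC.
rewrite s1 mul1r /FS patchE mem_set ?rE//=.
rewrite /sphere_set/= /unit_sphere/= ?rE enormZ ger0_norm ?invr_ge0 ?enorm_ge0// mulVf//.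
by case/andP: s1 => /lt0r_neq0.
Qed.

(** The two terms are the values on the two hemispheres over v, and 1/q is the density of surface
    area with respect to dv. *)
Definition hemisphere_sum {d} (F : 'rV[R]_d.+1 -> R) (v : 'rV[R]_d) : R :=
  let q := Num.sqrt (1 - enorm v ^+ 2) in
  (enorm v < 1)%R%:R * ((F (row_cons q v) + F (row_cons (- q) v)) / q).

Section hemisphere.
Context {d : nat} (F : 'rV[R]_d.+1 -> R).
Hypothesis mF : measurable_fun setT (F \o @row_of_tuple R d.+1).
Hypothesis F0 : forall v, 0 <= F v.

Let H := hemisphere_sum F.

(** The integrand on the sphere of radius rho once (t, v) is replaced by (rho, v): [t] and [- t] are
    the two heights over v, and [rho / t] is dt/drho. *)
Let K (rho : R) (v : 'rV[R]_d) : R :=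
  let t := Num.sqrt (rho ^+ 2 - enorm v ^+ 2) in
  ((enorm v < rho) && (rho <= 1))%R%:R *
  ((F (rho^-1 *: row_cons t v) + F (rho^-1 *: row_cons (- t) v)) * (rho / t)).

Let H_ge0 v : 0 <= H v.
Proof. by rewrite mulr_ge0// divr_ge0 ?addr_ge0// sqrtr_ge0. Qed.

Let K_ge0 rho v : 0 <= K rho v.
Proof.
rewrite /K; have [/andP[v1 _]|_] := boolP (_ && _); last by rewrite mul0r.
rewrite mul1r mulr_ge0 ?addr_ge0// divr_ge0 ?sqrtr_ge0//.
by rewrite (le_trans (enorm_ge0 v))// ltW.
Qed.

Let measurable_K d0 (T : measurableType d0) (r : T -> R) (f : T -> 'rV[R]_d) :
  measurable_fun setT r -> measurable_row f ->
  measurable_fun setT (fun x => (K (r x) (f x))%:E).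
Proof.
move=> mr mf; have me := measurable_enorm_row _ mf.
have mt : measurable_fun setT (fun x => Num.sqrt (r x ^+ 2 - enorm (f x) ^+ 2)).
  by apply: measurable_fun_sqrt; apply: measurable_funB; exact: measurable_funX.
apply/measurable_EFinP; apply: measurable_funM.
  apply: measurable_fun_natb; apply: measurable_and.
    exact: measurable_fun_ltr.
  exact: measurable_fun_ler.
apply: measurable_funM; last first.
  by apply: measurable_funM => //; exact: measurable_funV.
apply: measurable_funD; apply: (measurable_comp_row _ _ _ _ F _ mF);
  apply: measurable_rowZ; [exact: measurable_funV| |exact: measurable_funV|];
  apply: measurable_row_cons => //; exact: measurable_funN.
Qed.

Lemma measurable_hemisphere_sum : measurable_fun setT
  (fun s : d.-tuple R => (hemisphere_sum F (row_of_tuple s))%:E).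
Proof.
have mf : measurable_row (fun s : d.-tuple R => row_of_tuple s).
  exact: measurable_row_of_tuple.
have me := measurable_enorm_row _ mf.
have mq : measurable_fun setT
    (fun s : d.-tuple R => Num.sqrt (1 - enorm (row_of_tuple s) ^+ 2)).
  by apply: measurable_fun_sqrt; apply: measurable_funB => //; exact: measurable_funX.
apply/measurable_EFinP; apply: measurable_funM.
  by apply: measurable_fun_natb; exact: measurable_fun_ltr.
apply: measurable_funM; last exact: measurable_funV.
apply: measurable_funD; apply: (measurable_comp_row _ _ _ _ F _ mF);
  apply: measurable_row_cons => //; exact: measurable_funN.
Qed.

(** Apart from the cutoff rho <= 1, [K] is homogeneous of degree 0, so the dilation y = rho s
    separates the variables. *)
Let K_scale rho v : 0 < rho -> K rho (rho *: v) = (rho <= 1)%R%:R * H v.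
Proof.
move=> r0; have rn0 : rho != 0 by rewrite gt_eqF.
rewrite /K /H /hemisphere_sum enormZ gtr0_norm// gtr_pMr//.
have -> : Num.sqrt (rho ^+ 2 - (rho * enorm v) ^+ 2) =
    rho * Num.sqrt (1 - enorm v ^+ 2).
  rewrite exprMn -[X in X - _]mulr1 -mulrBr sqrtrM ?sqr_ge0// sqrtr_sqr gtr0_norm//.
rewrite !scale_row_cons mulrN mulKf// scalerA mulVf// scale1r.
set q := Num.sqrt (1 - _).
have -> : rho / (rho * q) = q^-1 by rewrite invfM mulVKf.
rewrite [RHS]mulrA; congr (_ * _).
by rewrite -natrM mulnb andbC.
Qed.

(** Both points have norm phi, which exceeds |v| because t > 0. Only the cutoff phi <= 1 remains,
    and t / phi cancels the factor phi / t in [K]. *)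
Let slice_sym (v : 'rV[R]_d) (t : R) : 0 < t ->
  let phi := Num.sqrt (t ^+ 2 + enorm v ^+ 2) in
  let P w := (0 < enorm w <= 1)%R%:R * F ((enorm w)^-1 *: w) in
  P (row_cons t v) + P (row_cons (- t) v) = t / phi * K phi v.
Proof.
move=> t0 phi P.
have tn0 : t != 0 by rewrite gt_eqF.
have p2 : phi ^+ 2 = t ^+ 2 + enorm v ^+ 2 by rewrite sqr_sqrtr// addr_ge0 ?sqr_ge0.
have pgt : enorm v < phi.
  by rewrite -(ltr_pXn2r (n := 2)) ?nnegrE ?enorm_ge0 ?sqrtr_ge0// p2 ltrDr exprn_gt0.
have p0 : 0 < phi by rewrite (le_lt_trans (enorm_ge0 v)).
have pn0 : phi != 0 by rewrite gt_eqF.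
rewrite /P !enorm_row_cons sqrrN -/phi p0/= -mulrDr /K pgt/=.
have -> : Num.sqrt (phi ^+ 2 - enorm v ^+ 2) = t.
  by rewrite p2 addrK sqrtr_sqr gtr0_norm.
by field; rewrite tn0 pn0.
Qed.

(** The line is folded onto t > 0, then phi is substituted with c = |v|; [K] vanishes for rho <=
    |v|, as the substitution requires. *)
Let integral_slice (v : 'rV[R]_d) :
  (\int[lam]_t ((0 < enorm (row_cons t v) <= 1)%R%:R *
     F ((enorm (row_cons t v))^-1 *: row_cons t v))%R%:E =
   \int[lam]_rho (K rho v)%:E)%E.
Proof.
have mrc (f : R -> R) : measurable_fun setT f -> measurable_row (fun t => row_cons (f t) v).
  by move=> mf; apply: measurable_row_cons => //; exact: measurable_row_cst.
rewrite ge0_integral_lebesgue_sym; first last.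
- by move=> t; rewrite lee_fin mulr_ge0.
- by apply: measurable_cone => //; exact: mrc.
rewrite [RHS](integral_hyperbolic_substitution (enorm v)); first last.
- by move=> rho; rewrite leNgt /K => /negbTE ->; rewrite mul0r.
- by move=> rho; rewrite lee_fin.
- by apply: measurable_K => //; exact: measurable_row_cst.
- exact: enorm_ge0.
apply: eq_integral => t; rewrite inE/= in_itv/= andbT => t0.
by rewrite -EFinD -EFinM; congr EFin; exact: slice_sym.
Qed.

Lemma ge0_integral_sphere_hemisphere :
  (\int[@sphere_measure R d.+1]_(w in sphere_set d.+1) (F (row_of_tuple w))%:E =
   \int[L d]_s (hemisphere_sum F (row_of_tuple s))%:E)%E.
Proof.
rewrite ge0_integral_sphere_measure//.
have mrow k : measurable_row (fun s : k.-tuple R => row_of_tuple s).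
  exact: measurable_row_of_tuple.
rewrite ge0_integral_lebesgue_tupleS; first last.
- by move=> t; rewrite lee_fin mulr_ge0.
- exact: measurable_cone.
under eq_integral => s _.
  under eq_integral do rewrite row_of_tuple_cons.
  rewrite integral_slice.
  over.
rewrite /=.
rewrite (fubini_tonelli (m1 := L d) (m2 := lam) (fun p : d.-tuple R * R =>
  (K p.2 (row_of_tuple p.1))%:E)); last 2 first.
- by apply: measurable_K => //; exact: measurable_row_of_tuple.
- by move=> p; rewrite lee_fin.
pose J := (\int[L d]_s (H (row_of_tuple s))%:E)%E.
have J0 : (0 <= J)%E by apply: integral_ge0 => s _; rewrite lee_fin.
(* Dilating by rho > 0 leaves rho^d times [J], which is independent of rho; for rho outside ]0, 1]
   the cutoffs in [K] give 0. *)
transitivity (d.+1%:R%:E * \int[lam]_(rho in `]0%R, 1%R]) ((rho ^+ d)%:E * J))%E.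
  congr (_ * _)%E; rewrite [RHS]integral_mkcond; apply: eq_integral => rho _ /=.
  rewrite patchE mem_setE in_itv/=.
  have [r0|r0] := ltP 0 rho; last first.
    rewrite integral0_eq// => s _.
    by rewrite /K ltNge (le_trans r0) ?enorm_ge0// mul0r.
  rewrite (ge0_integral_lebesgue_tuple_scale
    (fun v => (K rho v)%:E) _ _ rho 0 r0); last 2 first.
  - exact: measurable_K.
  - by move=> v; rewrite lee_fin.
  have -> : (\int[L d]_s (K rho (rho *: row_of_tuple s + 0))%:E =
      \int[L d]_s ((rho <= 1)%R%:R%:E * (H (row_of_tuple s))%:E))%E.
    by apply: eq_integral => s _; rewrite addr0 K_scale// EFinM.
  rewrite ge0_integralZl//; [|exact: measurable_hemisphere_sum|by move=> s _; rewrite lee_fin].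
  by rewrite -/J; case: (rho <= 1); rewrite ?mul1e ?mul0e ?mule0.
rewrite ge0_integralZr//; last 2 first.
- by apply/measurable_EFinP; apply: measurable_funTS; exact: measurable_funX.
- by move=> x; rewrite /= in_itv/= => /andP[x0 _]; rewrite lee_fin exprn_ge0// ltW.
by rewrite integral_expr01 muleA -EFinM mulfV ?mul1e.
Qed.

End hemisphere.
End sphere.

(** * Continuous functions on the sphere *)

(** V is the union of the countably many rational boxes it contains, and the preimage of a box is a
    finite intersection of preimages of intervals. *)
Lemma measurable_open_row {R : realType} {m} d0 (T : measurableType d0)
    (f : T -> 'rV[R]_m) (V : set 'rV[R]_m) :
  measurable_row f -> open V -> measurable (f @^-1` V).
Proof.
move=> mf oV.
pose box (q : {ffun 'I_m -> rat * rat}) : set 'rV[R]_m :=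
  [set v | forall i, (ratr (q i).1 < v 0 i) /\ (v 0 i < ratr (q i).2)].
have -> : f @^-1` V = \bigcup_q (if `[< box q `<=` V >] then f @^-1` box q else set0).
  apply/seteqP; split => [x Vfx|x [q _]]; last by case: asboolP => // bV; apply: bV.
  have [P Pf PV] : nbhs (f x) V by move: oV; rewrite openE; exact.
  have /choice[q qP] : forall i, exists q : rat * rat,
      [/\ ratr q.1 < f x 0 i, f x 0 i < ratr q.2 &
       forall y, ratr q.1 < y -> y < ratr q.2 -> P 0 i y].
    move=> i; have /nbhs_ballP[e /= e0 eP] := Pf 0 i.
    have fl : f x 0 i - e < f x 0 i by rewrite ltrBlDr ltrDl.
    have fr : f x 0 i < f x 0 i + e by rewrite ltrDl.
    have [[q1 + ] [q2]] := (rat_in_itvoo fl, rat_in_itvoo fr).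
    rewrite !in_itv/= => /andP[q11 q12] /andP[q21 q22].
    exists (q1, q2); split => //= y y1 y2; apply: eP.
    rewrite /ball/= ltr_distlC (lt_trans _ y1)//=.
    by rewrite (lt_trans y2).
  exists [ffun i => q i] => //; case: asboolP => [_|nV]; last first.
    exfalso; apply: nV => v vb; apply: PV => i j; rewrite ord1.
    have [_ _ +] := qP j; have := vb j; rewrite ffunE => -[v1 v2] /(_ _ v1 v2); exact.
  by move=> i; rewrite ffunE; have [? ? _] := qP i.
apply: countable_bigcupT_measurable; first exact: countableP.
move=> q; case: asboolP => // _.
have -> : f @^-1` box q = \bigcap_(i in [set: 'I_m])
    ((fun x => f x 0 i) @^-1` `]ratr (q i).1, ratr (q i).2[).
  apply/seteqP; split => [x bx i _|x bx i]; rewrite /= ?in_itv/=.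
    by have [-> ->] := bx i.
  by have := bx i I; rewrite /= in_itv/= => /andP.
apply: fin_bigcap_measurable => // i _.
by rewrite -[X in measurable X]setTI; apply: mf => //; exact: measurable_itv.
Qed.

(** The preimage of an open interval under f is, within A, the trace of an open V. Since x maps D
    into A, its preimage in D is that of V. *)
Lemma measurable_within_continuous_row {R : realType} {m} d0 (T : measurableType d0)
    (x : T -> 'rV[R]_m) (A : set 'rV[R]_m) (f : 'rV[R]_m -> R) (D : set T) :
  measurable_row x -> {within A, continuous f} -> measurable D ->
  (forall t, D t -> A (x t)) -> measurable_fun D (f \o x).
Proof.
move=> mx /continuousP cf mD DA.
apply: (measurability _ (RGenOpens.measurableE R)) => _ [_ [a [b ->] <-]].
have /open_subspaceP[V oV VA] := cf _ (@interval_open R (BRight a) (BLeft b) isT isT).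
rewrite (_ : _ `&` _ = D `&` x @^-1` V); last first.
  apply/seteqP; split => t [Dt xt]; split => //.
    have : (f @^-1` `]a, b[%classic `&` A) (x t) by split => //; exact: DA.
    by rewrite -VA => -[].
  have : (V `&` A) (x t) by split => //; exact: DA.
  by rewrite VA => -[].
by apply: measurableI => //; exact: measurable_open_row.
Qed.

Section unit_sphere.
Context {R : realType} {m : nat}.

Lemma continuous_enorm : continuous (@enorm R m).
Proof.
move=> v; apply: continuous_comp; last exact: sqrt_continuous.
rewrite (_ : (fun x => dotv x x) = (fun x : 'rV[R]_m => \sum_i x 0 i * x 0 i)).
  apply: (@continuous_big _ _ +%R 0) => [|i _ w]; first exact: add_continuous.
  have cc : continuous (fun v : 'rV[R]_m => v 0 i) by exact: coord_continuous.
  exact: (cvgM (cc w) (cc w)).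
by apply/funext => x; rewrite dotvE.
Qed.

Lemma norm_coord_le_enorm (v : 'rV[R]_m) i : `|v 0 i| <= enorm v.
Proof.
rewrite -sqrtr_sqr ler_sqrt ?dotv_ge0// dotvE (bigD1 i)//= -expr2 lerDl.
by apply: sumr_ge0 => j _; rewrite -expr2 sqr_ge0.
Qed.

Lemma compact_unit_sphere : compact (@unit_sphere R m).
Proof.
apply: (subclosed_compact _ (rV_compact (fun _ => @segment_compact R (-1) 1))).
  rewrite (_ : unit_sphere = enorm @^-1` [set 1])//.
  by move/continuous_closedP: continuous_enorm; apply; exact: closed_eq.
move=> v /= v1 i; rewrite /= in_itv/= -ler_norml.
by rewrite (le_trans (norm_coord_le_enorm _ _))// v1.
Qed.

Lemma bounded_unit_sphere (f : 'rV[R]_m -> R) :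
  {within unit_sphere, continuous f} ->
  exists M, forall v, unit_sphere v -> `|f v| <= M.
Proof.
move=> cf.
have [M [_ /(_ (M + 1))]] := compact_bounded (continuous_compact cf compact_unit_sphere).
rewrite ltrDl => /(_ ltr01) fM; exists (M + 1) => v v1.
by apply: fM; exists v.
Qed.

End unit_sphere.

(** * Signed integrands *)

Section signed.
Context {R : realType}.
Local Notation L := (@lebesgue_tuple R).
Local Notation sigma d := (@sphere_measure R d).

(** On |s| <= 1 one has 1 <= exp(1 - |s|^2), so the cone integrand is at most M e times the
    Gaussian. *)
Lemma ge0_integral_sphere_lty d (F : 'rV[R]_d -> R) M :
  measurable_fun setT (F \o @row_of_tuple R d) ->
  (forall v, 0 <= F v) -> (forall v, F v <= M) ->
  (\int[sigma d]_(w in sphere_set d) (F (row_of_tuple w))%:E < +oo)%E.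
Proof.
move=> mF F0 FM.
have M0 : 0 <= M by rewrite (le_trans (F0 0)).
rewrite ge0_integral_sphere_measure//.
have mrow : measurable_row (fun s : d.-tuple R => row_of_tuple s).
  exact: measurable_row_of_tuple.
apply: (@le_lt_trans _ _ (d%:R%:E * ((M * expR 1)%:E * (Num.sqrt pi ^+ d)%:E))%E); last first.
  by rewrite -!EFinM ltry.
apply: lee_pmul; rewrite ?lee_fin//.
  by apply: integral_ge0 => s _; rewrite lee_fin mulr_ge0.
rewrite -integral_lebesgue_tuple_gauss -ge0_integralZl//; last 2 first.
- exact: measurable_gauss_tuple.
- by rewrite lee_fin mulr_ge0// expR_ge0.
apply: ge0_le_integral => //.
- by move=> s _; rewrite lee_fin mulr_ge0.
- exact: measurable_cone.
- by apply: emeasurable_funM => //; exact: measurable_gauss_tuple.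
move=> s _; rewrite -EFinM lee_fin -mulrA -expRD.
case: (boolP (_ && _)) => [/andP[_ s1]|_]; last by rewrite mul0r mulr_ge0// expR_ge0.
rewrite mul1r (le_trans (FM _))// ler_peMr// -[leLHS]expR0 ler_expR subr_ge0.
by rewrite expr_le1// enorm_ge0.
Qed.

Lemma integral_sphereE d (F : 'rV[R]_d -> R) :
  (\int[sigma d]_(w in sphere_set d) (F (row_of_tuple w))%:E =
   \int[sigma d]_(w in sphere_set d) (F^\+ (row_of_tuple w))%:E -
   \int[sigma d]_(w in sphere_set d) (F^\- (row_of_tuple w))%:E)%E.
Proof.
rewrite integralE; congr (_ - _)%E; apply: eq_integral => w _.
  by rewrite funeposE EFin_max.
by rewrite funenegE EFin_max EFinN.
Qed.

(** An orthogonal matrix preserves norms and commutes with scaling, so for nonnegative functions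
    this is the invariance of Lebesgue measure applied to the cone integrand. *)
Lemma integral_sphere_orthogonal d (F : 'rV[R]_d -> R) (O : 'M[R]_d) :
  O *m O^T = 1%:M -> measurable_fun setT (F \o @row_of_tuple R d) ->
  (\int[sigma d]_(w in sphere_set d) (F (row_of_tuple w *m O))%:E =
   \int[sigma d]_(w in sphere_set d) (F (row_of_tuple w))%:E)%E.
Proof.
move=> OO mF.
have mrow : measurable_row (fun s : d.-tuple R => row_of_tuple s).
  exact: measurable_row_of_tuple.
suff ge0 (h : 'rV[R]_d -> R) : measurable_fun setT (h \o @row_of_tuple R d) ->
    (forall v, 0 <= h v) ->
    (\int[sigma d]_(w in sphere_set d) (h (row_of_tuple w *m O))%:E =
     \int[sigma d]_(w in sphere_set d) (h (row_of_tuple w))%:E)%E.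
  rewrite (integral_sphereE _ (fun v => F (v *m O))) [RHS]integral_sphereE.
  by congr (_ - _)%E; [apply: (ge0 (F^\+))|apply: (ge0 (F^\-))] => //;
    [exact: measurable_funrpos|exact: measurable_funrneg].
move=> mh h0.
rewrite (ge0_integral_sphere_measure _ (fun v => h (v *m O)))//; last first.
  by apply: (measurable_comp_row _ _ _ _ h _ mh); exact: measurable_row_mulmx.
rewrite (ge0_integral_sphere_measure _ h)//; congr (_ * _)%E.
pose k (v : 'rV[R]_d) := ((0 < enorm v <= 1)%R%:R * h ((enorm v)^-1 *: v))%:E.
rewrite -[RHS](ge0_integral_lebesgue_tuple_orthogonal _ k O OO); last 2 first.
- exact: measurable_cone.
- by move=> v; rewrite lee_fin mulr_ge0.
by apply: eq_integral => s _; rewrite /k enorm_mulmx// scalemxAl.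
Qed.

Section hemisphere.
Context {d : nat} (F : 'rV[R]_d.+1 -> R) (M : R).
Hypothesis mF : measurable_fun setT (F \o @row_of_tuple R d.+1).
Hypothesis FM : forall v, `|F v| <= M.

(** The absolute value is at most [hemisphere_sum] of |F|, whose integral is the sphere integral of
    a bounded nonnegative function. *)
Lemma integrable_hemisphere_sum :
  (L d).-integrable setT (fun s => (hemisphere_sum F (row_of_tuple s))%:E).
Proof.
apply/integrableP; split; first exact: measurable_hemisphere_sum.
pose G v := `|F v|.
have mG : measurable_fun setT (G \o @row_of_tuple R d.+1).
  exact: (measurableT_comp (@normr_measurable R setT) mF).
have := ge0_integral_sphere_lty _ G M mG (fun _ => normr_ge0 _) FM.
rewrite (ge0_integral_sphere_hemisphere G mG (fun _ => normr_ge0 _)).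
apply: le_lt_trans.
apply: ge0_le_integral => //.
- by apply: measurableT_comp => //; exact: measurable_hemisphere_sum.
- exact: (measurable_hemisphere_sum G mG).
move=> s _; rewrite lee_fin /hemisphere_sum normrM normr_nat ler_wpM2l//.
rewrite normrM [`|_^-1|]ger0_norm ?invr_ge0 ?sqrtr_ge0//.
by rewrite ler_wpM2r ?invr_ge0 ?sqrtr_ge0// ler_normD.
Qed.

End hemisphere.

(** [hemisphere_sum] is linear in F, and boundedness makes its values on the positive and negative
    parts integrable, so the two integrals may be subtracted. *)
Lemma integral_sphere_hemisphere d (F : 'rV[R]_d.+1 -> R) (M : R) :
  measurable_fun setT (F \o @row_of_tuple R d.+1) -> (forall v, `|F v| <= M) ->
  (\int[sigma (d.+1)]_(w in sphere_set d.+1) (F (row_of_tuple w))%:E =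
   \int[L d]_s (hemisphere_sum F (row_of_tuple s))%:E)%E.
Proof.
move=> mF FM.
have mp : measurable_fun setT (F^\+ \o @row_of_tuple R d.+1) by exact: measurable_funrpos.
have mn : measurable_fun setT (F^\- \o @row_of_tuple R d.+1) by exact: measurable_funrneg.
have pM v : `|F^\+ v| <= M.
  rewrite ger0_norm// (le_trans _ (FM v))// /funrpos ge_max ler_norm normr_ge0//.
have nM v : `|F^\- v| <= M.
  by rewrite ger0_norm// (le_trans _ (FM v))// /funrneg ge_max -normrN ler_norm normr_ge0.
rewrite integral_sphereE !ge0_integral_sphere_hemisphere// -integralB//.
- apply: eq_integral => s _; rewrite -EFinB; congr EFin.
  rewrite /hemisphere_sum -mulrBr -mulrBl; congr (_ * (_ / _)).
  have FE v : F v = F^\+ v - F^\- v by rewrite -[in LHS](funrposBneg F).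
  by rewrite opprD addrACA -!FE.
- exact: (integrable_hemisphere_sum _ M).
- exact: (integrable_hemisphere_sum _ M).
Qed.

Lemma integral_lebesgue_tuple_dilate d (h : 'rV[R]_d -> R) r : 0 < r ->
  (L d).-integrable setT (fun s => (h (row_of_tuple s))%:E) ->
  (\int[L d]_s (h (r *: row_of_tuple s))%:E =
   (r ^- d)%:E * \int[L d]_s (h (row_of_tuple s))%:E)%E.
Proof.
move=> r0 ih; have mh := measurable_int _ ih.
have mr : measurable_row (fun s : d.-tuple R => r *: row_of_tuple s).
  by apply: measurable_rowZ => //; exact: measurable_row_of_tuple.
have dil (k : 'rV[R]_d -> \bar R) : measurable_fun setT (k \o @row_of_tuple R d) ->
    (forall v, 0 <= k v)%E ->
    (\int[L d]_s k (r *: row_of_tuple s) = (r ^- d)%:E * \int[L d]_s k (row_of_tuple s))%E.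
  move=> mk k0; rewrite (ge0_integral_lebesgue_tuple_scale k mk k0 r 0 r0).
  rewrite muleA -EFinM mulVf ?mul1e ?expf_neq0 ?gt_eqF//.
  by apply: eq_integral => s _; rewrite addr0.
have fp := integrable_pos_fin_num measurableT ih.
have fn := integrable_neg_fin_num measurableT ih.
(* Integrability keeps both parts finite, so the factor distributes over the difference. *)
rewrite [in RHS]integralE muleBr//; last exact: fin_num_adde_defr.
rewrite [LHS]integralE; congr (_ - _)%E.
- transitivity (\int[L d]_s ((EFin \o h)^\+ (r *: row_of_tuple s)%R))%E.
    by apply: eq_integral => s _; rewrite !funeposE.
  rewrite (dil (EFin \o h)^\+%E); first last.
  + by move=> v; exact: funepos_ge0.
  + by rewrite -funepos_comp; exact: measurable_funepos.
  by congr (_ * _)%E; apply: eq_integral => s _; rewrite !funeposE.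
- transitivity (\int[L d]_s ((EFin \o h)^\- (r *: row_of_tuple s)%R))%E.
    by apply: eq_integral => s _; rewrite !funenegE.
  rewrite (dil (EFin \o h)^\-%E); first last.
  + by move=> v; exact: funeneg_ge0.
  + by rewrite -funeneg_comp; exact: measurable_funeneg.
  by congr (_ * _)%E; apply: eq_integral => s _; rewrite !funenegE.
Qed.

End signed.

(** * Orthonormal bases and charts *)

Section euclid.
Context {R : realType} {m : nat}.
Implicit Types (x y z a : 'rV[R]_m) (W : {vspace 'rV[R]_m}).

Lemma dotvDl x y z : dotv (x + y) z = dotv x z + dotv y z.
Proof. by rewrite /dotv mulmxDl mxE. Qed.

Lemma dotvZl r x z : dotv (r *: x) z = r * dotv x z.
Proof. by rewrite /dotv -scalemxAl mxE. Qed.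

Lemma dotvC x y : dotv x y = dotv y x.
Proof. by rewrite !dotvE; apply: eq_bigr => i _; rewrite mulrC. Qed.

Lemma dotvNl x y : dotv (- x) y = - dotv x y.
Proof. by rewrite -scaleN1r dotvZl mulN1r. Qed.

Lemma dotvBl x y z : dotv (x - y) z = dotv x z - dotv y z.
Proof. by rewrite dotvDl dotvNl. Qed.

Lemma dotvDr x y z : dotv x (y + z) = dotv x y + dotv x z.
Proof. by rewrite dotvC dotvDl !(dotvC _ x). Qed.

Lemma dotv_eq0 x : (dotv x x == 0) = (x == 0).
Proof.
apply/idP/eqP => [|->]; last by rewrite /dotv mul0mx mxE.
rewrite dotvE psumr_eq0 => [|i _]; last by rewrite -expr2 sqr_ge0.
move=> /allP x0; apply/rowP => i; rewrite mxE; apply/eqP.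
by have := x0 i (mem_index_enum _); rewrite mulf_eq0 orbb.
Qed.

Lemma mulmx_tr_eq0 x y : x *m y^T = 0 <-> dotv x y = 0.
Proof.
rewrite /dotv; split => [->|xy]; first by rewrite mxE.
by apply/matrixP => i j; rewrite !ord1 xy mxE.
Qed.

Lemma enorm_neq0 a : a != 0 -> enorm a != 0.
Proof. by move=> a0; rewrite sqrtr_eq0 -ltNge lt_neqAle dotv_ge0 andbT eq_sym dotv_eq0. Qed.

Lemma dotv_unit_vector a : a != 0 -> dotv (unit_vector a) (unit_vector a) = 1.
Proof.
move=> a0; have e0 := enorm_neq0 a a0.
rewrite dotvZl dotvC dotvZl -enorm_sqr expr2; field; exact: e0.
Qed.

Lemma dotv_unit_vectorr x a : dotv x a = 0 -> dotv x (unit_vector a) = 0.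
Proof. by move=> xa; rewrite dotvC dotvZl dotvC xa mulr0. Qed.

(** The subspace counterpart of the set [hyperplane a], for dimension counts. *)
Definition perp a : {vspace 'rV[R]_m} := lker (linfun (mulmxr a^T)).

Lemma mem_perp a x : (x \in perp a) = (dotv x a == 0).
Proof.
rewrite memv_ker lfunE/=; apply/eqP/eqP => /mulmx_tr_eq0//.
Qed.

(** Rank-nullity for x -> <x, a> on W: the image is at most one-dimensional and contains <a, a>,
    which is nonzero. *)
Lemma dim_cap_perp W a d :
  a \in W -> a != 0 -> \dim W = d.+1 -> \dim (W :&: perp a) = d.
Proof.
move=> aW a0 dW.
have := limg_ker_dim (linfun (mulmxr a^T)) W; rewrite dW -/(perp a).
suff -> : \dim (linfun (mulmxr a^T) @: W) = 1%N by rewrite addn1 => -[].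
apply/eqP; rewrite eqn_leq; apply/andP; split.
  by rewrite (leq_trans (dimvS (subvf _)))// dimvf.
rewrite lt0n dimv_eq0; apply/negP => /eqP W0.
have : linfun (mulmxr a^T) a \in (linfun (mulmxr a^T) @: W)%VS by exact: memv_img.
rewrite W0 memv0 lfunE/= => /eqP/mulmx_tr_eq0/eqP.
by rewrite dotv_eq0 (negbTE a0).
Qed.

Definition orthonormal_basis d W (G : 'M[R]_(d, m)) :=
  G *m G^T = 1%:M /\ (forall x, x \in W <-> exists s, x = s *m G).

Lemma mul_row_cons d t (s : 'rV[R]_d) a (G : 'M[R]_(d, m)) :
  row_cons t s *m (col_mx a G : 'M[R]_(d.+1, m)) = t *: a + s *m G.
Proof. by rewrite (mul_row_col (t%:M : 'M[R]_1)) mul_scalar_mx. Qed.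

(** A vector of W minus its component along a stays in W and is orthogonal to a, hence is a
    combination of the rows of G. *)
Lemma orthonormal_basis_cons d W a (G : 'M[R]_(d, m)) :
  a \in W -> a != 0 -> orthonormal_basis d (W :&: perp a) G ->
  orthonormal_basis d.+1 W (col_mx (unit_vector a) G : 'M[R]_(1 + d, m)).
Proof.
move=> aW a0 [GG GW].
have ua1 := dotv_unit_vector _ a0.
have Ga s : dotv (s *m G) (unit_vector a) = 0.
  have : s *m G \in (W :&: perp a)%VS by apply/GW; exists s.
  by rewrite memv_cap mem_perp => /andP[_ /eqP/dotv_unit_vectorr].
have Ga0 : G *m (unit_vector a)^T = 0.
  apply/row_matrixP => i; rewrite row0 row_mul rowE.
  exact/mulmx_tr_eq0.
have BB : col_mx (unit_vector a) G *m (col_mx (unit_vector a) G)^T = 1%:M.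
  rewrite tr_col_mx mul_col_mx !mul_mx_row GG Ga0.
  have -> : unit_vector a *m G^T = 0 by rewrite -[LHS]trmxK trmx_mul trmxK Ga0 trmx0.
  have -> : unit_vector a *m (unit_vector a)^T = 1%:M.
    by apply/matrixP => i j; rewrite !ord1 [LHS]ua1 mxE eqxx.
  by rewrite (scalar_mx_block 1 d).
split; first exact: BB.
have uaW : unit_vector a \in W by rewrite memvZ.
move=> x; split => [xW|[s ->]]; last first.
  have -> : s = row_cons (s 0 ord0) (\row_j s 0 (lift ord0 j)).
    apply/rowP => i; case: (unliftP ord0 i) => [j|] ->; last by rewrite row_cons0.
    by rewrite row_consS mxE.
  rewrite mul_row_cons memvD ?memvZ//.
  have : (\row_j s 0 (lift ord0 j)) *m G \in (W :&: perp a)%VS by apply/GW; eexists.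
  by rewrite memv_cap => /andP[].
have : x - dotv x (unit_vector a) *: unit_vector a \in (W :&: perp a)%VS.
  rewrite memv_cap memvB ?memvZ//= mem_perp; apply/eqP.
  rewrite dotvBl dotvZl (dotvC x (unit_vector a)) !dotvZl -enorm_sqr (dotvC a x).
  by field; exact: enorm_neq0.
move=> /GW[s sG]; exists (row_cons (dotv x (unit_vector a)) s).
by rewrite mul_row_cons -sG addrC subrK.
Qed.

(** Gram-Schmidt by induction on the dimension: a nonzero vector of W is split off, and its
    orthogonal complement in W has dimension one less. *)
Lemma exists_orthonormal_basis d W : \dim W = d ->
  exists G : 'M[R]_(d, m), orthonormal_basis d W G.
Proof.
elim: d W => [|d IH] W dW.
  exists 0; split; first by rewrite [LHS]flatmx0 [RHS]flatmx0.
  move=> x; have /eqP W0 : \dim W == 0%N by rewrite dW.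
  move/eqP: W0; rewrite dimv_eq0 => /eqP ->; rewrite memv0.
  split => [/eqP ->|[s ->]]; first by exists 0; rewrite mul0mx.
  by rewrite mulmx0.
have a0 : vpick W != 0 by rewrite vpick0 -dimv_eq0 dW.
have [G GW] := IH _ (dim_cap_perp W _ _ (memv_pick W) a0 dW).
by exists (col_mx (unit_vector (vpick W)) G); apply: orthonormal_basis_cons => //;
  exact: memv_pick.
Qed.

Lemma is_chart_affine_plane d W u (G : 'M[R]_(d, m)) :
  orthocomplement W u -> orthonormal_basis d W G ->
  is_chart (affine_plane W u) (u, G).
Proof.
move=> uW [GG GW]; split => //=.
  have Gu : G *m u^T = 0.
    apply/row_matrixP => i; rewrite row0 row_mul rowE; apply/mulmx_tr_eq0.
    by rewrite dotvC; apply: uW; apply/GW; eexists.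
  by rewrite -[LHS]trmxK trmx_mul trmxK Gu trmx0.
apply/seteqP; split => [x [w /= /GW[s ->] <-]|x [s _ <-]]; first by exists s.
by exists (s *m G) => //=; apply/GW; exists s.
Qed.

Lemma orthonormal_basis_chart d W u (G : 'M[R]_(d, m)) :
  is_chart (affine_plane W u) (u, G) -> orthonormal_basis d W G.
Proof.
move=> [/= GG _ WG]; split => // x; split => [xW|[s ->]].
  have : affine_plane W u (u + x) by exists x.
  by rewrite WG => -[s _ /addrI <-]; exists s.
have : [set u + s *m G | s in [set: 'rV[R]_d]] (u + s *m G) by exists s.
by rewrite -WG => -[w wW /addrI <-].
Qed.

(** Base points: p - u is orthogonal to both p and u, hence zero. Frames: the rows of E lie in the
    row space of B, so E = (E B^T) B, and E B^T is orthogonal. *)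
Lemma is_chart_unique d tau u (B : 'M[R]_(d, m)) F :
  is_chart tau (u, B) -> is_chart tau F ->
  F.1 = u /\ exists2 O : 'M[R]_d, O *m O^T = 1%:M & F.2 = O *m B.
Proof.
case: F => p E [/= BB uB tauB] [/= EE pE tauE].
have dot0 z (D : 'M[R]_(d, m)) s : z *m D^T = 0 -> dotv z (s *m D) = 0.
  by move=> zD; rewrite /dotv trmx_mul mulmxA zD mul0mx mxE.
have pu : p = u.
  have : tau p by rewrite tauE; exists 0 => //; rewrite mul0mx addr0.
  rewrite tauB => -[s0 _ ps0].
  have : tau u by rewrite tauB; exists 0 => //; rewrite mul0mx addr0.
  rewrite tauE => -[s1 _ us1].
  apply/eqP; rewrite -subr_eq0 -dotv_eq0 dotvBl.
  have -> : dotv u (p - u) = 0 by rewrite -{1}ps0 addrC addKr dot0.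
  have -> : p - u = - (s1 *m E) by rewrite -us1 opprD addrA subrr sub0r.
  by rewrite dotvC dotvNl dotvC dot0// !oppr0 addr0.
have EBB : E *m B^T *m B = E.
  apply/row_matrixP => i; rewrite !row_mul rowE.
  have : tau (p + delta_mx 0 i *m E) by rewrite tauE; exists (delta_mx 0 i).
  rewrite tauB pu => -[s _ /addrI <-].
  by rewrite -(mulmxA s) BB mulmx1.
split=> //; exists (E *m B^T); last by rewrite EBB.
by rewrite trmx_mul trmxK mulmxA EBB.
Qed.

End euclid.

(** * The slice *)

Lemma enorm_sqrD {R : realType} {m} (x y : 'rV[R]_m) :
  dotv x y = 0 -> enorm (x + y) ^+ 2 = enorm x ^+ 2 + enorm y ^+ 2.
Proof.
by move=> xy; rewrite !enorm_sqr dotvDl !dotvDr (dotvC y x) xy addr0 add0r.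
Qed.

Lemma row_cons_eta {R : realType} {d} (v : 'rV[R]_d.+1) :
  v = row_cons (v 0 ord0) (\row_j v 0 (lift ord0 j)).
Proof.
apply/rowP => i; case: (unliftP ord0 i) => [j|] ->; last by rewrite row_cons0.
by rewrite row_consS mxE.
Qed.

Section slice.
Context {R : realType} {n d : nat}.
Variables (a u : 'rV[R]_n.+1) (f : 'rV[R]_n.+1 -> R) (G : 'M[R]_(d, n.+1)).
Hypothesis a0 : a != 0.
Hypothesis ua : dotv u a = 0.
Hypothesis u1 : enorm u < 1.
Hypothesis GG : G *m G^T = 1%:M.
Hypothesis uG : u *m G^T = 0.
Hypothesis Ga : forall s, dotv (s *m G) a = 0.
Hypothesis cf : {within unit_sphere, continuous f}.

Let B : 'M[R]_(d.+1, n.+1) := col_mx (unit_vector a) G.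
Let r := Num.sqrt (1 - enorm u ^+ 2).
Let x (v : 'rV[R]_d.+1) := u + (r *: v) *m B.

(** The value 0 off the unit sphere keeps this function measurable and bounded everywhere, f being
    controlled only on [unit_sphere]. *)
Definition slice_pullback (v : 'rV[R]_d.+1) : R :=
  if enorm v == 1 then f (x v) else 0.

Let F := slice_pullback.

Let r_sqr : r ^+ 2 = 1 - enorm u ^+ 2.
Proof. by rewrite sqr_sqrtr// subr_ge0 expr_le1// ?enorm_ge0// ltW. Qed.

Let r_gt0 : 0 < r.
Proof. by rewrite sqrtr_gt0 subr_gt0 expr_lt1// enorm_ge0. Qed.

Let dot_uG s : dotv u (s *m G) = 0.
Proof. by rewrite /dotv trmx_mul mulmxA uG mul0mx mxE. Qed.

Let enorm_sliceE t s :
  enorm (u + s *m G + t *: unit_vector a) ^+ 2 = enorm u ^+ 2 + enorm s ^+ 2 + t ^+ 2.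
Proof.
rewrite enorm_sqrD ?enorm_sqrD ?enorm_mulmx ?dot_uG//; last first.
  rewrite dotvC dotvZl dotvC dotvDl (dotv_unit_vectorr _ _ ua).
  by rewrite (dotv_unit_vectorr _ _ (Ga s)) addr0 mulr0.
by congr (_ + _); rewrite !enorm_sqr dotvZl dotvC dotvZl dotv_unit_vector// mulr1 expr2.
Qed.

Let xE t s : x (row_cons t s) = u + (r *: s) *m G + (r * t) *: unit_vector a.
Proof. by rewrite /x scale_row_cons mul_row_cons addrA addrAC. Qed.

Let x_sphere v : enorm v = 1 -> unit_sphere (x v).
Proof.
move=> v1; rewrite /unit_sphere/=.
apply/eqP; rewrite -(@eqrXn2 _ 2) ?enorm_ge0// expr1n.
move: v1; rewrite (row_cons_eta v); set t := v 0 ord0; set s := \row_j _ => v1.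
rewrite xE enorm_sliceE enormZ !exprMn real_normK ?num_real// -addrA -mulrDr.
have -> : enorm s ^+ 2 + t ^+ 2 = 1.
  have := congr1 (fun y => y ^+ 2) v1.
  by rewrite enorm_row_cons expr1n sqr_sqrtr ?addr_ge0 ?sqr_ge0// addrC.
by rewrite mulr1 r_sqr addrC subrK.
Qed.

Lemma measurable_slice_pullback :
  measurable_fun setT (F \o @row_of_tuple R d.+1).
Proof.
have mD := @measurable_sphere_set R d.+1.
rewrite (_ : _ \o _ =
    (f \o (fun w : d.+1.-tuple R => x (row_of_tuple w))) \_ (sphere_set d.+1)).
  apply/(measurable_restrictT _ _).1 => //.
  apply: measurable_within_continuous_row => //; last first.
    by move=> w /= w1; exact: x_sphere.
  apply: measurable_rowD; first exact: measurable_row_cst.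
  apply: measurable_row_mulmx; apply: measurable_rowZ => //.
  exact: measurable_row_of_tuple.
apply/funext => w; rewrite patchE /F /slice_pullback /=.
by congr (if _ then _ else _); apply/eqP/idP => [?|/set_mem//]; exact/mem_set.
Qed.

Lemma bounded_slice_pullback : exists M, forall v, `|F v| <= M.
Proof.
(* The maximum with 0 covers the default value of [F]. *)
have [M fM] := bounded_unit_sphere _ cf; exists (Num.max M 0) => v.
rewrite /F /slice_pullback; case: eqP => [/x_sphere/fM|_].
  by move=> fxM; rewrite le_max fxM.
by rewrite normr0 le_max lexx orbT.
Qed.

Let enorm_slice0 s : enorm (u + s *m G) ^+ 2 = enorm u ^+ 2 + enorm s ^+ 2.
Proof. by rewrite enorm_sqrD ?dot_uG// enorm_mulmx. Qed.

Lemma enorm_slice_lt1 s : (enorm (u + s *m G) < 1) = (enorm (r^-1 *: s) < 1).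
Proof.
rewrite enormZ gtr0_norm ?invr_gt0// mulrC ltr_pdivrMr// mul1r.
rewrite -(@ltr_pXn2r _ 2) ?nnegrE ?enorm_ge0// expr1n enorm_slice0.
by rewrite -[RHS](@ltr_pXn2r _ 2) ?nnegrE ?enorm_ge0 ?(ltW r_gt0)// r_sqr ltrBrDl.
Qed.

(** With v = s / r and q = sqrt (1 - |v|^2), the height over y = u + s G is r q. The reflection
    swaps the points of heights r q and - r q, so twice the even part is the sum over both
    hemispheres, and the division by r q yields the factor [r^-1]. *)
Lemma hemisphere_funE s : enorm (u + s *m G) < 1 ->
  hemisphere_fun a (even_part a f) (u + s *m G) =
  r^-1 * hemisphere_sum F (r^-1 *: s).
Proof.
move=> y1; have v1 := y1; rewrite enorm_slice_lt1 in v1.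
have rn0 : r != 0 by rewrite gt_eqF.
rewrite /hemisphere_sum v1 mul1r /hemisphere_fun; set v := r^-1 *: s.
set q := Num.sqrt (1 - enorm v ^+ 2).
have q2 : q ^+ 2 = 1 - enorm v ^+ 2.
  by rewrite sqr_sqrtr// subr_ge0 expr_le1// ?enorm_ge0// ltW.
have q0 : q != 0 by rewrite gt_eqF// sqrtr_gt0 subr_gt0 expr_lt1// enorm_ge0.
have -> : Num.sqrt (1 - enorm (u + s *m G) ^+ 2) = r * q.
  have -> : 1 - enorm (u + s *m G) ^+ 2 = r ^+ 2 * (1 - enorm v ^+ 2).
    rewrite enorm_slice0 /v enormZ exprMn real_normK ?num_real// exprVn mulrBr mulr1.
    by rewrite mulVKf ?expf_neq0// r_sqr opprD addrA.
  by rewrite sqrtrM ?sqr_ge0// sqrtr_sqr gtr0_norm.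
have FE t : t ^+ 2 = q ^+ 2 -> F (row_cons t v) = f (u + s *m G + (r * t) *: unit_vector a).
  move=> tq; rewrite /F /slice_pullback enorm_row_cons tq q2 subrK sqrtr1 eqxx xE.
  by rewrite /v scalerA mulfV// scale1r.
rewrite !FE ?sqrrN// /even_part.
have -> : reflection a (u + s *m G + (r * q) *: unit_vector a) =
    u + s *m G + (r * - q) *: unit_vector a.
  rewrite /reflection dotvDl dotvZl dotv_unit_vector// mulr1 dotvDl.
  rewrite (dotv_unit_vectorr _ _ ua) (dotv_unit_vectorr _ _ (Ga s)) !add0r.
  by rewrite -addrA -scalerBl; congr (_ + _ *: _); ring.
by field; rewrite rn0 q0.
Qed.

End slice.

(** The slice meets both sides of the hyperplane while [hemisphere_fun] evaluates its argument on
    one side only, whence [even_part]. For f invariant under the reflection the even part is f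
    itself on the sphere, which gives the second conjunct. *)
Theorem lemma3p1 (R : realType) (n k : nat) (a : 'rV[R]_n.+1)
    (f : 'rV[R]_n.+1 -> R) (zeta0 : {vspace 'rV[R]_n.+1}) (u : 'rV[R]_n.+1)
    (hk1 : (1 < k)%N) (hkn : (k <= n)%N) (ha : a != 0)
    (hf : {within unit_sphere, continuous f})
    (hdim : \dim zeta0 = k) (ha0 : a \in zeta0)
    (hu0 : orthocomplement zeta0 u) (hua : hyperplane a u) (hu1 : enorm u < 1)
    (hzeta : parallel_planes k a (affine_plane zeta0 u)) :
  let zeta := affine_plane zeta0 u in
  let ball := hyperplane a `&` unit_ball in
  parallel_slice k f zeta =
    ((Num.sqrt (1 - enorm u ^+ 2))%:E *
     radon_john k.-1 ball (hemisphere_fun a (even_part a f))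
       (hyperplane a `&` zeta))%E
  /\
  ((forall x, unit_sphere x -> f (reflection a x) = f x) ->
   parallel_slice k f zeta =
    ((Num.sqrt (1 - enorm u ^+ 2))%:E *
     radon_john k.-1 ball (hemisphere_fun a f) (hyperplane a `&` zeta))%E).
Proof.
move=> zeta ball.
have r0 : 0 < Num.sqrt (1 - enorm u ^+ 2).
  by rewrite sqrtr_gt0 subr_gt0 expr_lt1// enorm_ge0.
case: k hk1 hkn hdim hzeta => [//|d] _ _ hdim _ /=.
(* As u is orthogonal to a, u + w lies in the hyperplane exactly when w does. *)
have tauE : hyperplane a `&` zeta = affine_plane (zeta0 :&: perp a) u.
  apply/seteqP; split => [y [ya [w /= w0 wy]]|y [w /=]].
    exists w => //=; rewrite memv_cap w0 mem_perp.
    by move: ya; rewrite -wy /hyperplane/= dotvDl hua add0r => ->.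
  rewrite memv_cap mem_perp => /andP[w0 /eqP wa] <-; split; last by exists w.
  by rewrite /hyperplane/= dotvDl hua wa addr0.
have dW : \dim (zeta0 :&: perp a) = d by exact: dim_cap_perp.
have uW : orthocomplement (zeta0 :&: perp a) u.
  by move=> w; rewrite memv_cap => /andP[+ _]; exact: hu0.
have [G0 G0W] := exists_orthonormal_basis _ _ dW.
have ch0 := is_chart_affine_plane _ _ _ _ uW G0W.
(* One chart exists, so [chart] returns a genuine chart and not its default value. *)
have : is_chart (hyperplane a `&` zeta) (chart d (hyperplane a `&` zeta)).
  by apply: (xgetPex (0, 0)); exists (u, G0); rewrite tauE.
case tauG : (chart d _) => [p G]; rewrite tauE => chG.
have [/= pu _] := is_chart_unique _ _ _ _ _ ch0 chG; subst p.
(* The basis of [zeta0] is built on the chosen G itself, so that only the frame of [zeta] needs an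
   orthogonal correction [P]. *)
have GW := orthonormal_basis_chart _ _ _ _ chG.
have [GG uG _] := chG; rewrite /= in GG uG.
have Ga s : dotv (s *m G) a = 0.
  have : s *m G \in (zeta0 :&: perp a)%VS by apply/(GW.2); exists s.
  by rewrite memv_cap mem_perp => /andP[_ /eqP].
have BW := orthonormal_basis_cons _ _ _ _ ha0 ha GW.
have chB := is_chart_affine_plane _ _ _ _ hu0 BW.
have : is_chart zeta (chart d.+1 zeta) by apply: (xgetPex (0, 0)); eexists; exact: chB.
case zetaE : (chart d.+1 zeta) => [p E] chE.
have [/= pu [P PP EP]] := is_chart_unique _ _ _ _ _ chB chE; subst p.
set r := Num.sqrt _ in r0 *.
pose F := slice_pullback a u f G.
have mF : measurable_fun setT (F \o @row_of_tuple R d.+1) by exact: measurable_slice_pullback.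
have [M FM] : exists M, forall v, `|F v| <= M by exact: bounded_slice_pullback.
have lhs : parallel_slice d.+1 f zeta =
    ((r ^+ d)%:E * \int[lebesgue_tuple R d]_s (hemisphere_sum F (row_of_tuple s))%:E)%E.
  rewrite /parallel_slice zetaE -/r /=; congr (_ * _)%E.
  (* Since E = P B, the slice integrand at w is [F] at w P, and orthogonal invariance absorbs
     [P]. *)
  rewrite -(integral_sphere_hemisphere _ _ M)// -(integral_sphere_orthogonal _ _ P)//.
  apply: eq_integral => w /set_mem w1; congr EFin.
  have wP : enorm (row_of_tuple w *m P) == 1 by rewrite enorm_mulmx//; apply/eqP.
  by rewrite /F /slice_pullback wP EP -scalemxAl mulmxA -scalemxAl.
have ballE s : ball (u + s *m G) <-> enorm (u + s *m G) < 1.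
  split => [[]//|s1]; split => //.
  by rewrite /hyperplane/= dotvDl hua Ga addr0.
have radE : (r%:E *
     radon_john d ball (hemisphere_fun a (even_part a f)) (hyperplane a `&` zeta) =
   (r ^+ d)%:E * \int[lebesgue_tuple R d]_s (hemisphere_sum F (row_of_tuple s))%:E)%E.
  rewrite /radon_john tauG.
  have ihs := integrable_hemisphere_sum _ _ mF FM.
  (* The cutoff inside [hemisphere_sum] extends the integrand by 0 outside the ball. *)
  transitivity (r%:E * \int[lebesgue_tuple R d]_s
      (r^-1 * hemisphere_sum F (r^-1 *: row_of_tuple s))%R%:E)%E.
    congr (_ * _)%E; rewrite integral_mkcond; apply: eq_integral => s _.
    rewrite patchE; case: ifPn => [/set_mem/= /ballE s1|/negP s1].
      by rewrite hemisphere_funE.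
    rewrite /hemisphere_sum -(enorm_slice_lt1 u G hu1 GG uG).
    case: (boolP (_ < 1)) => [s2|_]; last by rewrite mul0r mulr0.
    by exfalso; apply: s1; apply/mem_set/ballE.
  rewrite (integral_lebesgue_tuple_dilate _ (fun v => r^-1 * hemisphere_sum F v)); first last.
  - by under eq_fun do rewrite EFinM; exact: integrableZl.
  - by rewrite invr_gt0.
  under eq_integral do rewrite EFinM.
  (* Dilation by r^-1 contributes r^d; the other factors r and r^-1 cancel. *)
  rewrite integralZl// !muleA -!EFinM; congr (_%:E * _)%E.
  by rewrite exprVn invrK; field; rewrite gt_eqF.
rewrite -tauE; split; first by rewrite lhs radE.
(* [hemisphere_fun] evaluates f only at points of the sphere, where the invariance applies. *)
move=> feven; rewrite lhs -radE; congr (_ * _)%E.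
rewrite /radon_john tauG; apply: eq_integral => s /set_mem/= [ya y1].
congr EFin; rewrite /hemisphere_fun; congr (_ * _).
rewrite /even_part feven; first by field.
rewrite /unit_sphere/=; apply/eqP; rewrite -(@eqrXn2 _ 2) ?enorm_ge0// expr1n.
set y := u + _ in ya y1 *.
rewrite enorm_sqrD; last by rewrite dotvC dotvZl dotvC dotv_unit_vectorr ?mulr0.
rewrite [X in _ + X]enorm_sqr dotvZl dotvC dotvZl dotv_unit_vector// mulr1 -expr2.
by rewrite [X in _ + X]sqr_sqrtr ?subrKC// subr_ge0 expr_le1// ?enorm_ge0// ltW.
Qed.
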